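(* Let $(R,q)$ be a non-singular $2m$-dimensional quadratic space of plus type over $\mathbb{F}_2$, let $k$ be a positive integer, and let $\Phi,\Psi$ be maximal totally singular subspaces of $(R,q)$. Let $G$ be the stabilizer of $\mathcal{S}(\Phi,\Psi;k)$ in $\mathrm{Aut}(R^k,w^k)$. Let $H$ be the stabilizer of $\Phi$ in $O(R,q)$ and let $K$ be the stabilizer of $\Psi$ in $H$. If $k\ge3$ and $\Phi\cap\Psi=0$, then $G$ is generated by $O_2(H)_{(1i)}\ (\cong 2^{\binom{m}{2}})$ for $2\le i\le k$, $K_{(12\dots k)}\ (\cong \mathrm{SL}_m(2))$ and $\mathrm{Sym}_k$, and $G$ has the shape $2^{(k-1)\binom{m}{2}}:(\mathrm{SL}_m(2)\times\mathrm{Sym}_k)$.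
   Context: A quadratic form on an $\mathbb{F}_2$-vector space $R$ is a map $q:R\to\mathbb{F}_2$ such that $\langle a,b\rangle=q(a+b)+q(a)+q(b)$ is a symmetric bilinear form with $\langle a,a\rangle=0$ for all $a$; it is non-singular if $\langle\ ,\ \rangle$ is non-degenerate. A subspace is totally singular if $q$ vanishes on it. A non-singular $q$ on a $2m$-dimensional space is of plus type if maximal totally singular subspaces have dimension $m$. $O(R,q)$ is the subgroup of $\mathrm{GL}(R)$ preserving $q$. $R^k$ is the orthogonal direct sum of $k$ copies of $R$, with quadratic form $q^k(a_1,\dots,a_k)=\sum_{i=1}^k q(a_i)$. Define $w:R\to\{0,1,2\}$ by $w(a)=0$ if $a=0$, $w(a)=1$ if $q(a)=1$, and $w(a)=2$ if $q(a)=0$ and $a\neq0$; define $w^k:R^k\to\{0,1,\dots,2k\}$ by $w^k(a_1,\dots,a_k)=\sum_{i=1}^k w(a_i)$. $\mathrm{Aut}(R^k,w^k)$ is the subgroup of $\mathrm{GL}(R^k)$ preserving $w^k$. The direct product $O(R,q)^k$ of $k$ copies of $O(R,q)$ acts coordinatewise on $R^k$, and $\mathrm{Sym}_k$, the symmetric group of degree $k$, acts on $R^k$ by permuting the coordinates; both actions preserve $w^k$, and these groups are regarded as subgroups of $\mathrm{Aut}(R^k,w^k)$. Define $$\mathcal{S}(\Phi,\Psi;k)=\Big\{(a_1+b,a_2+b,\dots,a_k+b)\in R^k\ \Big|\ a_i\in\Phi,\ b\in\Psi,\ \sum_{i=1}^k a_i\in\Phi\cap\Psi\Big\}.$$ For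 a subgroup $F$ of $O(R,q)$, $F_{(ij)}=\{(g_1,\dots,g_k)\in O(R,q)^k\mid g_i=g_j\in F,\ g_l=1\text{ if }l\ne i,j\}$ and $F_{(12\dots k)}=\{(h,\dots,h)\in O(R,q)^k\mid h\in F\}$. $O_2(H)$ is the maximal normal $2$-subgroup of $H$. $2^n$ denotes an elementary abelian $2$-group of order $2^n$, $\mathrm{SL}_m(2)$ is the special linear group of degree $m$ over $\mathbb{F}_2$, and $A:B$ denotes a split extension with normal subgroup $A$ and quotient $B$.
   Formalization: The formal theorem assumes m ≥ 1 and, if m = 2, k ≥ 5: for (m,k) = (2,3), (2,4) the stabilizer G has order at least 2160 and 8064 rather than the claimed 144 and 1152, and for m = 0 G is trivial and cannot contain Sym_k. *)

(* Defs.v *)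
From HB Require Import structures.
From mathcomp Require Import all_boot all_order all_fingroup all_algebra.
From mathcomp Require Import pgroup abelian finfield.
Set Implicit Arguments.
Unset Strict Implicit.
Unset Printing Implicit Defensive.
Import GRing.Theory.
Local Open Scope ring_scope.

Section QuadraticForms.
Variables (R : vectType 'F_2) (q : R -> 'F_2).
Implicit Types (a b : R) (U W : {vspace R}).

Definition polar a b : 'F_2 := q (a + b) + q a + q b.

Definition quadratic_form : Prop :=
  [/\ forall b, scalar (fun a => polar a b),
      forall a, scalar (polar a),
      forall a b, polar a b = polar b a
    & forall a, polar a a = 0].

Definition nonsingular : Prop :=
  forall a, (forall b, polar a b = 0) -> a = 0.

Definition totally_singular U : Prop := forall a, a \in U -> q a = 0.

Definition max_totally_singular U : Prop :=
  totally_singular U /\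
  forall W, totally_singular W -> (U <= W)%VS -> W = U.

Definition plus_type (m : nat) : Prop :=
  \dim {:R} = (2 * m)%N /\ forall U, max_totally_singular U -> \dim U = m.

Definition weight a : nat :=
  (if a == 0%R then 0 else if q a == 1%R then 1 else 2)%N.

Definition weight_pow k (v : {ffun 'I_k -> R}) : nat :=
  (\sum_i weight (v i))%N.

End QuadraticForms.

Section LinearGroups.
Variable V : vectType 'F_2.
Local Notation fV := (finvect_type V).
Implicit Types g h : {perm fV}.

(* GL(V), realised as a group of permutations of the finite set V. *)
Definition GLperm : {set {perm fV}} :=
  [set g : {perm fV} | [forall c : 'F_2, forall u : fV, forall v : fV,
              g (c *: u + v) == c *: g u + g v]].

Lemma GLpermP g :
  reflect (forall (c : 'F_2) (u v : fV), g (c *: u + v) = c *: g u + g v)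
          (g \in GLperm).
Proof.
rewrite inE; apply: (iffP forallP) => [gP c u v | gP c].
  by have /forallP/(_ u)/forallP/(_ v)/eqP := gP c.
by apply/forallP=> u; apply/forallP=> v; rewrite gP.
Qed.

Definition preservers (X : eqType) (f : V -> X) : {set {perm fV}} :=
  [set g in GLperm | [forall v : fV, f (g v) == f v]].

Lemma preserversP (X : eqType) (f : V -> X) g :
  reflect (g \in GLperm /\ forall v : fV, f (g v) = f v)
          (g \in preservers f).
Proof.
apply: (iffP setIdP) => [] [gL gf]; split=> //.
  by move=> v; apply/eqP/(forallP gf).
by apply/forallP=> v; rewrite gf.
Qed.

Lemma preservers_group_set (X : eqType) (f : V -> X) :
  group_set (preservers f).
Proof.
apply/group_setP; split=> [|g h].
  by apply/preserversP; split=> [|v]; [apply/GLpermP=> c u v|]; rewrite !perm1.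
case/preserversP=> /GLpermP gL gf /preserversP[/GLpermP hL hf].
apply/preserversP; split=> [|v]; last by rewrite permM hf gf.
by apply/GLpermP=> c u v; rewrite !permM gL hL.
Qed.

Canonical preservers_group (X : eqType) (f : V -> X) :=
  Group (preservers_group_set f).

Definition vset (U : {vspace V}) : {set fV} := [set v : fV | (v : V) \in U].

End LinearGroups.

Section Powers.
Variables (R : vectType 'F_2) (k : nat).
Local Notation fR := (finvect_type R).
Local Notation Rk := (finvect_type {ffun 'I_k -> R}).
Implicit Types (g h : {ffun 'I_k -> {perm fR}}) (F : {group {perm fR}}).

Definition calS (Phi Psi : {vspace R}) : {set Rk} :=
  [set v : Rk | [exists a : Rk, exists b : fR,
     [&& [forall i, (a i : R) \in Phi], (b : R) \in Psi,
         \sum_i (a i : R) \in (Phi :&: Psi)%VS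
       & v == [ffun i => a i + b]]]].

Definition coordwise_fun g (v : Rk) : Rk := [ffun i => g i (v i)].

Lemma coordwise_fun_inj g : injective (coordwise_fun g).
Proof.
move=> u v /ffunP uv; apply/ffunP=> i.
by apply: (@perm.perm_inj _ (g i)); have := uv i; rewrite !ffunE.
Qed.

Definition coordwise g : {perm Rk} := perm (@coordwise_fun_inj g).

Lemma coordwiseM g h :
  coordwise [ffun i => (g i * h i)%g] = (coordwise g * coordwise h)%g.
Proof.
by apply/permP=> v; rewrite permM !permE; apply/ffunP=> i; rewrite !ffunE permM.
Qed.

Lemma coordwise1 : coordwise [ffun=> 1%g] = 1%g.
Proof.
by apply/permP=> v; rewrite !permE; apply/ffunP=> i; rewrite !ffunE perm1.
Qed.

Definition pair_sub (i j : 'I_k) (F : {set {perm fR}}) : {set {perm Rk}} :=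
  [set coordwise g | g : {ffun 'I_k -> {perm fR}} &
     [&& g i == g j, g i \in F
       & [forall l, (l != i) && (l != j) ==> (g l == 1%g)]]].

Lemma pair_sub_group_set i j F : group_set (pair_sub i j F).
Proof.
apply/group_setP; split=> [|x y].
  apply/imsetP; exists [ffun=> 1%g]; last by rewrite coordwise1.
  rewrite inE !ffunE eqxx group1; apply/forallP=> l.
  by rewrite ffunE eqxx implybT.
case/imsetP=> g; rewrite inE => /and3P[/eqP gij gF /forallP g1] ->.
case/imsetP=> h; rewrite inE => /and3P[/eqP hij hF /forallP h1] ->.
apply/imsetP; exists [ffun l => (g l * h l)%g]; last by rewrite coordwiseM.
rewrite inE !ffunE gij hij eqxx -gij -hij groupM //; apply/forallP=> l.
apply/implyP=> lij; rewrite ffunE.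
by rewrite (eqP (implyP (g1 l) lij)) (eqP (implyP (h1 l) lij)) mulg1.
Qed.

Canonical pair_sub_group i j F := Group (pair_sub_group_set i j F).

Definition diag_sub (F : {set {perm fR}}) : {set {perm Rk}} :=
  [set coordwise [ffun=> h] | h in F].

Lemma diag_sub_group_set F : group_set (diag_sub F).
Proof.
apply/group_setP; split=> [|x y].
  by apply/imsetP; exists 1%g; rewrite ?coordwise1.
case/imsetP=> g gF ->; case/imsetP=> h hF ->.
apply/imsetP; exists (g * h)%g; first exact: groupM.
by rewrite -coordwiseM; congr coordwise; apply/ffunP=> i; rewrite !ffunE.
Qed.

Canonical diag_sub_group F := Group (diag_sub_group_set F).

Definition permcoord_fun (s : 'S_k) (v : Rk) : Rk :=
  [ffun i => v ((s^-1)%g i)].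

Lemma permcoord_fun_inj s : injective (permcoord_fun s).
Proof.
move=> u v /ffunP uv; apply/ffunP=> i.
by have := uv (s i); rewrite !ffunE permK.
Qed.

Definition permcoord (s : 'S_k) : {perm Rk} := perm (@permcoord_fun_inj s).

Lemma permcoordM s t : permcoord (s * t)%g = (permcoord s * permcoord t)%g.
Proof.
apply/permP=> v; rewrite permM !permE; apply/ffunP=> i.
by rewrite !ffunE invMg permM.
Qed.

Definition Sym_sub : {set {perm Rk}} := [set permcoord s | s : 'S_k].

Lemma Sym_sub_group_set : group_set Sym_sub.
Proof.
apply/group_setP; split=> [|x y].
  apply/imsetP; exists 1%g => //; apply/permP=> v.
  by rewrite !permE; apply/ffunP=> i; rewrite !ffunE invg1 perm1.
case/imsetP=> s _ ->; case/imsetP=> t _ ->.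
by apply/imsetP; exists (s * t)%g; rewrite ?permcoordM.
Qed.

Canonical Sym_sub_group := Group Sym_sub_group_set.

End Powers.

(* The matrices in {'GL_n[F]} have size n.-1.+1, so this is SL_n(F) only for   *)
(* 0 < n.                                                                      *)
Definition SL (n : nat) (F : finFieldType) : {set {'GL_n[F]}} :=
  [set g | \det (GLval g) == 1].

Lemma SL_group_set n F : group_set (SL n F).
Proof.
apply/group_setP; split=> [|g h]; rewrite !inE ?det1 //.
by move=> /eqP g1 /eqP h1; rewrite det_mulmx g1 h1 mulr1.
Qed.

Canonical SL_group n F := Group (SL_group_set n F).

Definition elementary2 (gT : finGroupType) (E : {set gT}) (n : nat) : Prop :=
  (2.-abelem E)%g /\ #|E| = (2 ^ n)%N.

(* Main.v *)
Require Import Defs.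
From HB Require Import structures.
From mathcomp Require Import all_boot all_order all_fingroup all_algebra.
From mathcomp Require Import pgroup abelian finfield.
From mathcomp Require Import sylow zify.
Set Implicit Arguments.
Unset Strict Implicit.
Unset Printing Implicit Defensive.
Import GRing.Theory.
Local Open Scope ring_scope.

(* A block is one of the k summands R of R^k.  An element g of G permutes the     *)
(* vectors of weight one, i.e. the vectors z with q z = 1 inside some block, and  *)
(* it respects the relation of lying in a common block: for m <> 2 the graph of   *)
(* nonorthogonality on {z | q z = 1} is connected, and edges are visible to the   *)
(* weight; for m = 2 this fails (R^k is then the Hamming space F_4^(2k)), but for *)
(* k >= 5 the weight-four vectors of calS, which are the (a, a) with a in Phi     *)
(* placed in two blocks, detect the blocks.  So g permutes the blocks and is a    *)
(* coordinatewise isometry (h_i) followed by a coordinate permutation.            *)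
(* Applying (h_i) to the vectors (a, a) placed in two blocks, and using a third   *)
(* block, the h_i stabilize Phi and agree on it; up to one element of K they lie  *)
(* in U, the pointwise stabilizer of Phi, and the diagonal vectors (b, ..., b)    *)
(* with b in Psi then force their product to be 1.  Such tuples form the normal   *)
(* subgroup of G of order |U|^(k-1), complemented by K x Sym_k.  Finally U, which *)
(* corresponds to the alternating matrices of size m, is O_2(H), because H is     *)
(* transitive on the nonzero vectors of Phi.                                      *)

(** Three facts carry the argument.

    Rigidity. [same_block_dim] (for [m != 2]) and [same_block_calS] (for [5 <= k]) show that an
    element of G sends weight-one vectors of one block into one block. From this [block_image]
    deduces that whole blocks go to blocks: a nonzero singular vector has weight two, and were its
    image spread over two blocks, the inverse of g would bring weight-one vectors of two blocks into
    one. [monomial] then writes g as a tuple of isometries followed by a coordinate permutation.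

    The stabilizer of Phi. In dual bases of Phi and Psi ([dual_bases]) the space R is a space of
    pairs (x, y) with q(x, y) = x . y. There K is the general linear group, acting by A on x and by
    the inverse transpose on y ([stabPhiPsi_lift]); over F_2 it equals the special linear group. The
    pointwise stabilizer U of Phi consists of the maps that add to x the image of y under an
    alternating matrix ([fixPhi_shift]), so it has order 2^C(m,2), and H = UK ([stabPhi_decompose]).
    Since u |-> (r |-> r + u r) turns products in U into sums ([fixPhi_mul]), U is elementary
    abelian; [pcore_stabPhi] identifies it with ['O_2(H)].

    Gluing. A coordinatewise element of G is a tuple of elements of U with product 1 times a
    diagonal element of K ([coordwise_stabS]). Such tuples form the kernel of the product map from
    U^k onto U, which has order |U|^(k-1) and is generated by the elements having the same entry in
    the first and one further coordinate ([balanced_pairs]). Uniqueness of the monomial form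
    ([coordwise_permcoord_inj]) and U meeting K trivially make the extension split. *)

Section CharacteristicTwo.
Variable V : lmodType 'F_2.
Implicit Types (u v : V) (c : 'F_2).

Lemma F2_cases c : c = 0 \/ c = 1.
Proof. by case: c => [[|[|]]] // ?; [left|right]; apply: val_inj. Qed.

Lemma F2_neq0 c : c != 0 -> c = 1.
Proof. by case: (F2_cases c) => ->. Qed.

Lemma addvv v : v + v = 0.
Proof.
rewrite -[v]scale1r -scalerDl; have -> : 1 + 1 = 0 :> 'F_2 by apply: val_inj.
exact: scale0r.
Qed.

Lemma oppv v : - v = v.
Proof. by apply/eqP; rewrite eq_sym -addr_eq0 addvv. Qed.

Lemma addvK v : involutive (+%R^~ v).
Proof. by move=> u; rewrite -addrA addvv addr0. Qed.

Lemma addv_eq0 u v : (u + v == 0) = (u == v).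
Proof. by rewrite addr_eq0 oppv. Qed.

End CharacteristicTwo.

Lemma addF2 (c : 'F_2) : c + c = 0.
Proof. by case: (F2_cases c) => ->; apply: val_inj. Qed.

Lemma addF2_eq0 (a b : 'F_2) : a + b = 0 -> a = b.
Proof. by case: (F2_cases a) (F2_cases b) => -> [] ->. Qed.

(** The terms at (i, j) and (j, i) cancel in characteristic two; [enum_rank] supplies the order that
    separates the two halves off the diagonal. *)
Lemma sum_symmetric_F2 (I : finType) (a : I -> I -> 'F_2) :
  (forall i j, a i j = a j i) -> \sum_i \sum_j a i j = \sum_i a i i.
Proof.
move=> aC; rewrite pair_bigA (bigID (fun p => p.1 == p.2)) /=.
rewrite [X in _ + X](bigID
  (fun p : I * I => (enum_rank p.1 < enum_rank p.2)%N)) /=.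
set L := \sum_(p | _ && _) _; set L' := \sum_(p | _ && _) _.
have -> : L' = L.
  rewrite /L /L' (reindex (fun p : I * I => (p.2, p.1))) /=; last first.
    by exists (fun p : I * I => (p.2, p.1)) => [] [].
  apply: eq_big => [[i j]|[i j] _] //=; rewrite -leqNgt leq_eqVlt eq_sym.
  by case: eqVneq => //= ij; rewrite val_eqE (inj_eq enum_rank_inj) (negbTE ij).
rewrite addF2 addr0 (eq_bigr (fun p => a p.1 p.1)); last first.
  by case=> i j /= /eqP->.
rewrite (reindex_onto (fun i => (i, i)) (fun p => p.1)) /=; last first.
  by case=> i j /= /eqP->.
by apply: eq_bigl => i; rewrite eqxx.
Qed.

(** * Linear permutations and their stabilizers *)

Section LinearPermutations.
Variable V : vectType 'F_2.
Local Notation fV := (finvect_type V).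
Implicit Types (g : {perm fV}) (A : {set {perm fV}}) (S : {set fV}).

Lemma GLperm_additive g :
  reflect {morph g : u v / u + v} (g \in GLperm V).
Proof.
apply: (iffP (GLpermP g)) => [gL u v | gD c u v].
  by rewrite -[u]scale1r gL !scale1r.
have g0 : g 0 = 0 by apply: (@addIr _ (g 0)); rewrite -gD !add0r.
by rewrite gD; case: (F2_cases c) => ->; rewrite ?scale0r ?scale1r ?g0.
Qed.

Lemma setwise_stab_sub A S g :
  g \in A -> (forall v, v \in S -> g v \in S) -> g \in 'N_A(S | 'P)%g.
Proof.
move=> gA gS; apply/setIP; split=> //; rewrite !inE.
by apply/subsetP=> v vS; rewrite inE; apply: gS.
Qed.

Lemma setwise_stabP A S g :
  reflect (g \in A /\ forall v, (g v \in S) = (v \in S)) (g \in 'N_A(S | 'P)%g).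
Proof.
apply: (iffP setIP) => [[gA gS] | [gA gS]]; split=> //.
  by move=> v; have := astabs_act v gS.
by rewrite !inE; apply/subsetP=> v vS; rewrite inE /= [X in X \in S]apermE gS.
Qed.

Lemma pointwise_stabP A S g :
  reflect (g \in A /\ forall v, v \in S -> g v = v) (g \in 'C_A(S | 'P)%g).
Proof.
apply: (iffP setIP) => [[gA gS] | [gA gS]]; split=> //.
  by move=> v vS; have := astab_act gS vS.
by apply/astabP=> v vS; exact: gS.
Qed.

End LinearPermutations.

(** * Quadratic forms over F_2 and dual bases *)

Section QuadraticSpace.
Variables (R : vectType 'F_2) (q : R -> 'F_2).
Hypothesis q_quad : quadratic_form q.
Implicit Types a b c : R.

Lemma polarC a b : polar q a b = polar q b a.
Proof. by case: q_quad. Qed.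

Lemma polarvv a : polar q a a = 0.
Proof. by case: q_quad. Qed.

Lemma polarDl a b c : polar q (a + b) c = polar q a c + polar q b c.
Proof.
by case: q_quad => /(_ c) lin _ _ _; have := lin 1 a b; rewrite scale1r mul1r.
Qed.

Lemma polarDr a b c : polar q c (a + b) = polar q c a + polar q c b.
Proof. by rewrite polarC polarDl !(polarC c). Qed.

Lemma polar0l a : polar q 0 a = 0.
Proof. by apply: (@addIr _ (polar q 0 a)); rewrite -polarDl !add0r. Qed.

Lemma polarZl s a b : polar q (s *: a) b = s * polar q a b.
Proof.
by case: (F2_cases s) => ->; rewrite ?scale0r ?scale1r ?mul0r ?mul1r ?polar0l.
Qed.

Lemma polarZr s a b : polar q b (s *: a) = s * polar q b a.
Proof. by rewrite polarC polarZl polarC. Qed.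

Lemma polar_suml (I : Type) (r : seq I) (P : pred I) (F : I -> R) b :
  polar q (\sum_(i <- r | P i) F i) b = \sum_(i <- r | P i) polar q (F i) b.
Proof.
apply: (big_morph (fun a => polar q a b)) => [a c|]; last exact: polar0l.
exact: polarDl.
Qed.

Lemma polar_sumr (I : Type) (r : seq I) (P : pred I) (F : I -> R) b :
  polar q b (\sum_(i <- r | P i) F i) = \sum_(i <- r | P i) polar q b (F i).
Proof. by rewrite polarC polar_suml; under eq_bigr do rewrite polarC. Qed.

Lemma quad0 : q 0 = 0.
Proof. by have := polar0l 0; rewrite /polar addr0 addF2 add0r. Qed.

Lemma quadD a b : q (a + b) = q a + q b + polar q a b.
Proof.
rewrite /polar; move: (F2_cases (q a)) (F2_cases (q b)) (F2_cases (q (a + b))).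
by do 3![case=> ->]; apply: val_inj.
Qed.

Lemma totally_singular_polar (U : {vspace R}) a b :
  totally_singular q U -> a \in U -> b \in U -> polar q a b = 0.
Proof.
move=> tsU aU bU; have := tsU _ (rpredD aU bU).
by rewrite quadD !tsU // !add0r.
Qed.

End QuadraticSpace.

Lemma card_finvect (R : vectType 'F_2) :
  #|{: finvect_type R}| = (2 ^ \dim {:R})%N.
Proof.
have := @card_vspace _ _ (Vector.class (finvect_type R : vectType _)) fullv.
by rewrite (@card_vspacef _ _ (Vector.class (finvect_type R : vectType _)))
  card_Fp.
Qed.

(** The Gram matrix [M] between a basis of Phi and one of Psi is invertible: a row in its kernel
    gives a vector of Phi orthogonal to Psi, and also to Phi, hence to Phi + Psi = R. Multiplying
    the basis of Phi by the inverse of [M] makes the two bases dual. *)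
Lemma dual_bases (m : nat) (R : vectType 'F_2) (q : R -> 'F_2)
    (Phi Psi : {vspace R}) :
  quadratic_form q -> nonsingular q ->
  totally_singular q Phi -> totally_singular q Psi ->
  \dim {:R} = (2 * m)%N -> \dim Phi = m -> \dim Psi = m ->
  (Phi :&: Psi = 0)%VS ->
  exists e f : 'I_m -> R,
    [/\ forall i, e i \in Phi, forall i, f i \in Psi
      & forall i j, polar q (e i) (f j) = (i == j)%:R].
Proof.
move=> qq ns tsPhi tsPsi dimR dimPhi dimPsi capPP.
have fullPP : (Phi + Psi)%VS = fullv.
  apply/eqP; rewrite eqEdim subvf dimv_disjoint_sum // dimR dimPhi dimPsi.
  by rewrite mul2n addnn leqnn.
pose p i := (vbasis Phi)`_i; pose f i := (vbasis Psi)`_i.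
have pP (i : 'I_m) : p i \in Phi.
  by apply: vbasis_mem; rewrite mem_nth ?size_tuple ?dimPhi.
have fP (i : 'I_m) : f i \in Psi.
  by apply: vbasis_mem; rewrite mem_nth ?size_tuple ?dimPsi.
pose M : 'M['F_2]_m := \matrix_(i, j) polar q (p i) (f j).
have Mfree : row_free M.
  apply/row_freeP; exists (invmx M); rewrite mulmxV // -row_free_unit.
  rewrite -kermx_eq0; apply/rowV0P=> u /sub_kermxP uM.
  pose a := \sum_(i < m) u 0 i *: p i.
  have aPhi : a \in Phi by apply: rpred_sum => i _; apply: rpredZ.
  have a_f (j : 'I_m) : polar q a (f j) = 0.
    have := congr1 (fun N : 'rV_m => N 0 j) uM; rewrite !mxE => <-.
    rewrite polar_suml //; apply: eq_bigr => i _.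
    by rewrite polarZl // mxE.
  have a0 : a = 0.
    apply: ns => b; have : b \in (Phi + Psi)%VS by rewrite fullPP memvf.
    case/memv_addP=> b1 b1P [b2 b2P ->]; rewrite polarDr //.
    rewrite (totally_singular_polar tsPhi) // add0r.
    rewrite (coord_vbasis b2P) polar_sumr // big1 // => i _.
    rewrite polarZr //.
    have ltim : (i < m)%N by rewrite -dimPsi.
    by rewrite (a_f (Ordinal ltim)) mulr0.
  have := vbasisP Phi => /basis_free/freeP fr.
  apply/rowP=> i; rewrite mxE.
  have ltim : (i < \dim Phi)%N by rewrite dimPhi.
  rewrite -(fr (fun j => u 0 (cast_ord dimPhi j)) _ (Ordinal ltim)).
    by congr (u 0 _); apply: val_inj.
  rewrite -[RHS]a0 /a (reindex (cast_ord dimPhi)) //=.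
  by exists (cast_ord (esym dimPhi)) => j _; rewrite ?cast_ordK ?cast_ordKV.
have Munit : M \in unitmx by rewrite -row_free_unit.
exists (fun i => \sum_j invmx M i j *: p j), (fun i => f i); split=> //.
  by move=> i; apply: rpred_sum => j _; apply: rpredZ.
move=> i j; have := congr1 (fun N : 'M_m => N i j) (mulVmx Munit).
rewrite !mxE => <-; rewrite polar_suml //; apply: eq_bigr => l _.
by rewrite polarZl // mxE.
Qed.

(** * Linear permutations preserving a function *)

Section Preservers.
Variables (V : vectType 'F_2) (X : eqType) (w : V -> X).
Local Notation fV := (finvect_type V).
Implicit Types g : {perm fV}.

Lemma isometryP g :
  reflect ({morph g : u v / u + v} /\ forall v : V, w (g v) = w v)
          (g \in preservers w).
Proof.
apply: (iffP (preserversP _ _)) => [] [gD gw]; split=> //.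
  by apply/GLperm_additive.
by apply/GLperm_additive.
Qed.

Variables (g : {perm fV}) (g_iso : g \in preservers w).

Lemma isometryD (u v : V) : g (u + v) = (g u : V) + g v.
Proof. by case/isometryP: g_iso. Qed.

Lemma isometryE (v : V) : w (g v) = w v.
Proof. by case/isometryP: g_iso. Qed.

Lemma isometry0 : g 0 = 0 :> V.
Proof. by apply: (@addIr _ (g 0 : V)); rewrite -isometryD !add0r. Qed.

Lemma isometryZ c (v : V) : g (c *: v) = c *: (g v : V).
Proof.
by case: (F2_cases c) => ->; rewrite ?scale0r ?scale1r ?isometry0.
Qed.

Lemma isometry_sum (I : Type) (s : seq I) (P : pred I) (F : I -> V) :
  g (\sum_(i <- s | P i) F i) = \sum_(i <- s | P i) (g (F i) : V).
Proof. exact: (big_morph _ isometryD isometry0). Qed.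

End Preservers.

Lemma isometry_polar (R : vectType 'F_2) (q : R -> 'F_2)
    (g : {perm finvect_type R}) (u v : R) :
  g \in preservers q -> polar q (g u) (g v) = polar q u v.
Proof. by move=> gO; rewrite /polar -(isometryD gO) !(isometryE gO). Qed.

(** * Weights on R^k and the vectors of weight one and two *)

Section Weights.
Variables (R : vectType 'F_2) (q : R -> 'F_2) (k : nat).
Hypothesis q_quad : quadratic_form q.
Local Notation fR := (finvect_type R).
Local Notation Rk := (finvect_type {ffun 'I_k -> R}).
Local Notation w := (@weight_pow R q k).
Implicit Types (a b z : R) (i j l : 'I_k) (v : {ffun 'I_k -> R}).

Lemma weight_eq0 a : (weight q a == 0%N) = (a == 0).
Proof. by rewrite /weight; case: (a == 0) => //; case: ifP. Qed.

Lemma weight_eq1 a : (weight q a == 1%N) = (q a == 1).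
Proof.
rewrite /weight; case: (eqVneq a 0) => [->|_]; first by rewrite quad0.
by case: ifP.
Qed.

Lemma weight_eq2 a : (weight q a == 2%N) = (a != 0) && (q a == 0).
Proof.
rewrite /weight; case: (eqVneq a 0) => //= _.
by case: (F2_cases (q a)) => ->.
Qed.

Lemma weight_le2 a : (weight q a <= 2)%N.
Proof. by rewrite /weight; case: ifP => // _; case: ifP. Qed.

Lemma weight_quad a b : weight q a = weight q b -> q a = q b.
Proof.
move=> ab; have := weight_eq1 a; rewrite ab weight_eq1.
by case: (F2_cases (q a)) => ->; case: (F2_cases (q b)) => ->.
Qed.

Definition at_coord i a : {ffun 'I_k -> R} :=
  [ffun j => if j == i then a else 0].

Lemma at_coordE i a : at_coord i a i = a.
Proof. by rewrite ffunE eqxx. Qed.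

Lemma at_coordN i j a : j != i -> at_coord i a j = 0.
Proof. by rewrite ffunE => /negbTE->. Qed.

Lemma at_coordD i a b : at_coord i (a + b) = at_coord i a + at_coord i b.
Proof. by apply/ffunP=> j; rewrite !ffunE; case: ifP; rewrite ?addr0. Qed.

Lemma at_coord0 i : at_coord i 0 = 0.
Proof. by apply/ffunP=> j; rewrite !ffunE if_same. Qed.

Lemma at_coord_inj i : injective (at_coord i).
Proof. by move=> a b /ffunP/(_ i); rewrite !at_coordE. Qed.

Lemma at_coord_index i j a b : a != 0 -> at_coord i a = at_coord j b -> i = j.
Proof.
move=> a0 /ffunP/(_ i); rewrite at_coordE ffunE; case: eqP => // _ a0'.
by rewrite a0' eqxx in a0.
Qed.

Lemma sum_at_coord v : \sum_i at_coord i (v i) = v.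
Proof.
apply/ffunP=> j; rewrite sum_ffunE (bigD1 j) //= at_coordE big1 ?addr0 // => i
  ij.
by rewrite at_coordN // eq_sym.
Qed.

Lemma weight_pow_addE v i a :
  w (v + at_coord i a) =
  (weight q (v i + a)%R + \sum_(j | j != i) weight q (v j))%N.
Proof.
rewrite /weight_pow (bigD1 i) //= !ffunE eqxx; congr (_ + _)%N.
by apply: eq_bigr => j ji; rewrite !ffunE (negbTE ji) addr0.
Qed.

Lemma weight_powE v i :
  w v = (weight q (v i) + \sum_(j | j != i) weight q (v j))%N.
Proof. by rewrite /weight_pow (bigD1 i). Qed.

Lemma weight_pow_add v i a :
  (w (v + at_coord i a)%R + weight q (v i) = w v + weight q (v i + a)%R)%N.
Proof. rewrite weight_pow_addE (weight_powE v i) addnAC [RHS]addnAC.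
by congr (_ + _)%N; apply: addnC. Qed.

Lemma weight_pow_at i a : w (at_coord i a) = weight q a.
Proof.
rewrite -[at_coord i a]add0r weight_pow_addE ffunE add0r big1 ?addn0 // => j _.
by rewrite ffunE; apply/eqP; rewrite weight_eq0.
Qed.

Lemma weight_pow_at2 i j a b : i != j ->
  w (at_coord i a + at_coord j b) = (weight q a + weight q b)%N.
Proof.
move=> ij; have := weight_pow_add (at_coord i a) j b.
rewrite weight_pow_at at_coordN 1?eq_sym // add0r.
by rewrite (eqP (_ : weight q 0 == 0%N)) ?weight_eq0 // addn0.
Qed.

Lemma weight_pow1 v : w v = 1%N -> exists i z, q z = 1 /\ v = at_coord i z.
Proof.
move/eqP/sum_nat_eq1 => [i [_ /eqP]]; rewrite weight_eq1 => /eqP qz v0.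
exists i, (v i); split=> //; apply/ffunP=> j; rewrite ffunE.
by case: eqVneq => [->//|ji]; apply/eqP; rewrite -weight_eq0 v0.
Qed.

(** A nonzero coordinate accounts for one or two of the weight; clearing it leaves a vector of
    weight one or the zero vector. *)
Lemma weight_pow2 v : w v = 2%N ->
  (exists i a, v = at_coord i a) \/
  (exists i j z z', [/\ i != j, q z = 1, q z' = 1
                      & v = at_coord i z + at_coord j z']).
Proof.
move=> w2; have [i vi] : exists i, v i != 0.
  apply/existsP; apply: contra_eqT w2 => /existsPn v0.
  rewrite /weight_pow big1 // => i _; apply/eqP.
  by rewrite weight_eq0 -[_ == _]negbK v0.
have := weight_pow_add v i (v i); rewrite addvv w2.
have -> : weight q 0 = 0%N by apply/eqP; rewrite weight_eq0.
rewrite -weight_eq0 in vi.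
have: (0 < weight q (v i) <= 2)%N by rewrite weight_le2 lt0n vi.
have v_eq : v = at_coord i (v i) + (v + at_coord i (v i)).
  by rewrite addrC -addrA addvv addr0.
move def_c: (weight q (v i)) => c; case: c def_c => [|[|[|]]] // wvi _.
  rewrite addn1 => -[] /weight_pow1 [j [z' [qz' vE]]]; right.
  exists i, j, (v i), z'; split=> //.
  - apply/eqP => ij; move: vE; rewrite -ij => /ffunP/(_ i).
    rewrite !ffunE eqxx addvv => z0; by move: qz'; rewrite -z0 quad0.
  - by apply/eqP; rewrite -weight_eq1 wvi.
  - by rewrite {1}v_eq vE.
rewrite addn2 addn0 => -[] /eqP w0; left; exists i, (v i).
rewrite {1}v_eq (_ : v + _ = 0) ?addr0 //; apply/ffunP=> j;
  rewrite ffunE [RHS]ffunE.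
move: w0; rewrite /weight_pow sum_nat_eq0 => /forallP/(_ j)/implyP/(_ isT).
by rewrite weight_eq0 ffunE => /eqP.
Qed.

(** The zero vector lies in every block, so the relation determines a common index only for nonzero
    vectors. *)
Definition same_block v v' :=
  exists i a a', v = at_coord i a /\ v' = at_coord i a'.

Lemma same_block_index i j a b : a != 0 -> b != 0 ->
  same_block (at_coord i a) (at_coord j b) -> i = j.
Proof.
move=> a0 b0 [l [c [c' [ac bc']]]].
by rewrite (at_coord_index a0 ac) (at_coord_index b0 bc').
Qed.

Lemma unit_neq0 z : q z = 1 -> z != 0.
Proof.
by move=> qz; apply: contra_eq_neq qz => ->; rewrite quad0 // eq_sym oner_eq0.
Qed.

Lemma isometry_unit (g : {perm Rk}) i z : g \in preservers w -> q z = 1 ->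
  exists j z', q z' = 1 /\ g (at_coord i z) = at_coord j z'.
Proof.
move=> gw qz; apply: weight_pow1; rewrite (isometryE gw) weight_pow_at.
by apply/eqP; rewrite weight_eq1 qz.
Qed.

(* Weight-one vectors in distinct blocks have a sum of weight two, while [z + z'] *)
(* has weight one.                                                                *)
Lemma adjacent_same_block (g : {perm Rk}) i z z' : g \in preservers w ->
  q z = 1 -> q z' = 1 -> polar q z z' = 1 ->
  same_block (g (at_coord i z)) (g (at_coord i z')).
Proof.
move=> gw qz qz' zz'.
have [j [y [qy gz]]] := isometry_unit i gw qz.
have [l [y' [qy' gz']]] := isometry_unit i gw qz'.
have wD : w (at_coord j y + at_coord l y') = 1%N.
  rewrite -gz -gz' -(isometryD gw) (isometryE gw) -at_coordD weight_pow_at.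
  by apply/eqP; rewrite weight_eq1 quadD qz qz' zz' addF2 add0r.
exists j, y, y'; split=> //; rewrite gz'.
have [->//|jl] := eqVneq j l; move: wD; rewrite weight_pow_at2 //.
have /eqP-> : weight q y == 1%N by rewrite weight_eq1 qy.
by have /eqP-> : weight q y' == 1%N by rewrite weight_eq1 qy'.
Qed.

End Weights.

(** Take y1 not orthogonal to z and y2 not orthogonal to z + z'; one of y1, y2, y1 + y2 has the
    required products. The case z' = 0 is allowed and says only that z is not in the radical. *)
Lemma nonsingular_pair_split (R : vectType 'F_2) (q : R -> 'F_2) (z z' : R) :
  quadratic_form q -> nonsingular q -> z != 0 -> z != z' ->
  exists y, polar q y z = 1 /\ polar q y z' = 0.
Proof.
move=> qq ns z0 zz'.
have sep a : a != 0 -> exists y, polar q y a = 1.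
  move=> a0;
  have /existsP[y /eqP ya] : [exists y : finvect_type R, polar q y a == 1].
    apply: contraNT a0 => /existsPn ay; apply/eqP/ns => b; rewrite polarC //.
    by have := ay b; case: (F2_cases (polar q b a)) => ->.
  by exists y.
have [y1 y1z] := sep _ z0.
have [y2] : exists y, polar q y (z + z') = 1 by apply: sep; rewrite addv_eq0.
rewrite polarDr // => y2zz'.
case: (F2_cases (polar q y1 z')) => y1z'; first by exists y1.
case: (F2_cases (polar q y2 z)) => y2z; move: y2zz'; rewrite y2z.
  rewrite add0r => y2z'; exists (y1 + y2).
  by rewrite !polarDl // y1z y2z y1z' y2z' addr0 addF2.
case: (F2_cases (polar q y2 z')) => y2z'; first by exists y2.
by rewrite y2z' addF2 => /eqP; rewrite eq_sym oner_eq0.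
Qed.

(* If no such [y] exists then [{z, z'}^perp] is isotropic, hence equal to       *)
(* [<z, z'>], which forces [\dim R = 4].                                        *)
Lemma common_neighbour (R : vectType 'F_2) (q : R -> 'F_2) (m : nat)
    (z z' : R) :
  quadratic_form q -> nonsingular q -> \dim {:R} = (2 * m)%N -> m != 2%N ->
  q z = 1 -> q z' = 1 -> z != z' -> polar q z z' = 0 ->
  exists y, [/\ q y = 1, polar q y z = 1 & polar q y z' = 1].
Proof.
move=> qq ns dimR m2 qz qz' zz' pzz'.
have z0 := unit_neq0 qq qz; have z'0 := unit_neq0 qq qz'.
have [y1 [y1z y1z']] := nonsingular_pair_split qq ns z0 zz'.
have [|y2 [y2z' y2z]] := nonsingular_pair_split qq ns z'0 (_ : z' != z).
  by rewrite eq_sym.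
have [/existsP[y /and3P[/eqP ? /eqP ? /eqP ?]]|/existsPn noY] :=
  boolP [exists y : finvect_type R,
           [&& q y == 1, polar q y z == 1 & polar q y z' == 1]].
  by exists y.
have {}noY y : polar q y z = 1 -> polar q y z' = 1 -> q y = 0.
  by move=> yz yz'; have := noY y; rewrite yz yz' eqxx !andbT;
    case: (F2_cases (q y)) => ->.
pose W u := polar q u z = 0 /\ polar q u z' = 0.
have [y0 [y0z y0z']] : exists y, polar q y z = 1 /\ polar q y z' = 1.
  by exists (y1 + y2); rewrite !polarDl // y1z y2z y1z' y2z' add0r addr0.
(* Adding an element of [W] to [y0] keeps both products equal to 1, so [noY] applies again. Thus q
   is additive on [W], and the bilinear form vanishes there. *)
have qW u : W u -> q u = polar q y0 u.
  case=> uz uz'; have := noY (y0 + u).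
  rewrite !polarDl // y0z y0z' uz uz' addr0 => /(_ erefl erefl).
  by rewrite quadD noY // add0r => /addF2_eq0.
have WW u u' : W u -> W u' -> polar q u u' = 0.
  move=> Wu Wu'; have WD : W (u + u').
    by case: Wu Wu' => u1 u2 [u'1 u'2]; split;
      rewrite polarDl // ?u1 ?u2 ?u'1 ?u'2 addr0.
  have := qW _ WD; rewrite quadD !qW // polarDr // -[RHS]addr0.
  exact: addrI.
have decomp (r : R) : exists c : 'F_2 * 'F_2 * 'F_2 * 'F_2,
    r = c.1.1.1 *: z + c.1.1.2 *: z' + c.1.2 *: y1 + c.2 *: y2.
  have Wr s : W (s + polar q s z *: y1 + polar q s z' *: y2).
    split; rewrite !polarDl // !polarZl // ?y1z ?y2z ?y1z' ?y2z'.
      by rewrite mulr0 mulr1 addr0 addF2.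
    by rewrite mulr0 mulr1 addr0 addF2.
  have [t Wt rE] : exists2 t,
      W t & r = t + (polar q r z *: y1 + polar q r z' *: y2).
    exists (r + polar q r z *: y1 + polar q r z' *: y2); first exact: Wr.
    by rewrite -[X in _ = X + _]addrA -addrA addvv addr0.
  (* Every s becomes an element of [W] after adding multiples of y1 and y2, and t is orthogonal to
     [W]; expanding that product shows that the left side is orthogonal to s. *)
  have tE : t + (polar q y1 t *: z + polar q y2 t *: z') = 0.
    apply: ns => s; rewrite polarC // -[RHS](WW _ _ (Wr s) Wt).
    rewrite !polarDl // !polarDr // !polarZl // !polarZr // addrA.
    by rewrite ![polar q _ t * _]mulrC.
  exists (polar q y1 t, polar q y2 t, polar q r z, polar q r z') => /=.
  by move/eqP: tE; rewrite addv_eq0 => /eqP tE; rewrite -addrA -tE.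
have : (\dim {:R} <= 4)%N.
  have: (fullv <= <<[:: z; z'; y1; y2]>>)%VS.
    apply/subvP=> r _; have [c ->] := decomp r.
    by rewrite !rpredD // rpredZ // memv_span // !inE eqxx ?orbT.
  by move/dimvS/leq_trans; apply; apply: leq_trans (dim_span _) _.
(* With the spanning bound this makes the dimension exactly four, contradicting [m != 2]. *)
have : free [:: z; z'; y1; y2].
  apply/freeP => c; rewrite !big_ord_recl big_ord0 /= addr0 => c0.
  have p x : polar q (c ord0 *: z + (c (lift ord0 ord0) *: z' +
      (c (lift ord0 (lift ord0 ord0)) *: y1 +
       c (lift ord0 (lift ord0 (lift ord0 ord0))) *: y2))) x = 0.
    by rewrite c0 polar0l.
  have := p z; have := p z'.
  rewrite !polarDl // !polarZl // !polarvv // y1z y1z' y2z y2z' pzz'.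
  rewrite (polarC qq z') pzz'.
  rewrite !mulr0 !mulr1 !add0r !addr0 => c3 c2.
  have := p y1; have := p y2.
  rewrite !polarDl // !polarZl // c2 c3 (polarC qq z y1) (polarC qq z' y1)
    (polarC qq z y2) (polarC qq z' y2).
  rewrite y1z y1z' y2z y2z' !mul0r !mulr0 !mulr1 !add0r !addr0 => c1 c0' i.
  case: i => [[|[|[|[|]]]]] // i4.
  - by rewrite -[RHS]c0'; congr (c _); apply: val_inj.
  - by rewrite -[RHS]c1; congr (c _); apply: val_inj.
  - by rewrite -[RHS]c2; congr (c _); apply: val_inj.
  - by rewrite -[RHS]c3; congr (c _); apply: val_inj.
move/eqP=> /= dim4; rewrite dimR => le4.
have : (4 <= 2 * m)%N by rewrite -[4%N]dim4 -dimR dimvS // subvf.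
by move: m2 le4; rewrite /=; lia.
Qed.

(** * The subspace [calS] when Phi and Psi meet trivially *)

Lemma calSP (k : nat) (R : vectType 'F_2) (Phi Psi : {vspace R})
    (v : finvect_type {ffun 'I_k -> R}) :
  (Phi :&: Psi = 0)%VS ->
  reflect (exists a : {ffun 'I_k -> R}, exists b : R,
             [/\ forall i, a i \in Phi, b \in Psi, \sum_i a i = 0
               & v = [ffun i => a i + b]])
          (v \in calS k Phi Psi).
Proof.
move=> cap0; rewrite inE; apply: (iffP existsP) => [[a /existsP[b]] | [a [b]]].
  rewrite cap0 memv0 => /and4P[/forallP aP bP /eqP a0 /eqP->].
  by exists a, b.
case=> aP bP a0 ->; exists a; apply/existsP; exists b.
by rewrite cap0 memv0 a0 bP !eqxx !andbT; apply/forallP.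
Qed.

Lemma calS_pair (k : nat) (R : vectType 'F_2) (Phi Psi : {vspace R}) a
    (i j : 'I_k) :
  (Phi :&: Psi = 0)%VS -> a \in Phi ->
    at_coord i a + at_coord j a \in calS k Phi Psi.
Proof.
move=> cap0 aP; apply/calSP => //.
exists (at_coord i a + at_coord j a), 0; split; rewrite ?rpred0 //.
- by move=> x; rewrite !ffunE; do 2!case: ifP => _; rewrite ?rpredD ?rpred0.
- rewrite (eq_bigr (fun x => at_coord i a x + at_coord j a x)) => [|x _];
    last first.
    by rewrite !ffunE.
  rewrite big_split /=.
  have sum_at x : \sum_l at_coord x a l = a.
    by rewrite (bigD1 x) //= at_coordE big1 ?addr0 // => l lx;
      rewrite at_coordN.
  by rewrite !sum_at addvv.
- by apply/ffunP=> x; rewrite !ffunE addr0.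
Qed.

Lemma third_index (k : nat) (i j : 'I_k) :
  (3 <= k)%N -> exists l, (l != i) && (l != j).
Proof.
move=> k3; apply/existsP; apply: contraLR k3 => /existsPn lP;
  rewrite -ltnNge ltnS.
have : (#|[set i; j]| <= 2)%N by rewrite cards2; case: (_ != _).
apply: leq_trans; rewrite -[X in (X <= _)%N](card_ord k) -cardsT.
apply/subset_leq_card/subsetP=> l _; have := lP l.
by rewrite !inE negb_and !negbK.
Qed.

Section CoordinatePermutations.
Variables (R : vectType 'F_2) (k : nat).
Local Notation fR := (finvect_type R).
Local Notation Rk := (finvect_type {ffun 'I_k -> R}).

Lemma coordwiseE (g : {ffun 'I_k -> {perm fR}}) (v : Rk) i :
  (coordwise g v : {ffun 'I_k -> R}) i = g i ((v : {ffun 'I_k -> R}) i).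
Proof. by rewrite permE ffunE. Qed.

Lemma permcoordE (s : 'S_k) (v : Rk) i :
  (permcoord R s v : {ffun 'I_k -> R}) i = (v : {ffun 'I_k -> R}) ((s^-1)%g i).
Proof. by rewrite permE ffunE. Qed.

End CoordinatePermutations.

(** * Weight-preserving maps that permute the blocks *)

Section Monomial.
Variables (R : vectType 'F_2) (q : R -> 'F_2) (k : nat).
Hypotheses (q_quad : quadratic_form q) (q_ns : nonsingular q).
Local Notation fR := (finvect_type R).
Local Notation Rk := (finvect_type {ffun 'I_k -> R}).
Local Notation w := (@weight_pow R q k).
Implicit Types (g : {perm Rk}) (a b z : R) (i j l : 'I_k).

(** Nonorthogonal weight-one vectors stay together by [adjacent_same_block]; orthogonal ones are
    joined through a common neighbour. *)
Lemma same_block_dim (m : nat) g i z z' :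
  \dim {:R} = (2 * m)%N -> m != 2%N -> g \in preservers w -> q z = 1 ->
    q z' = 1 ->
  same_block (g (at_coord i z)) (g (at_coord i z')).
Proof.
move=> dimR m2 gw qz qz'.
have [<-|zz'] := eqVneq z z'.
  have [j [y [_ ->]]] := isometry_unit q_quad i gw qz; by exists j, y, y.
case: (F2_cases (polar q z z')) => pzz'; last exact: adjacent_same_block pzz'.
have [y [qy yz yz']] := common_neighbour q_quad q_ns dimR m2 qz qz' zz' pzz'.
have [j [y1 [qy1 gy]]] := isometry_unit q_quad i gw qy.
have [j1 [a [a' [ya za]]]] := adjacent_same_block q_quad i gw qy qz yz.
have [j2 [b [b' [yb zb]]]] := adjacent_same_block q_quad i gw qy qz' yz'.
have y10 := unit_neq0 q_quad qy1; rewrite gy in ya yb.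
exists j1, a', b'; split=> //; rewrite zb.
by rewrite -(at_coord_index y10 ya) -(at_coord_index y10 yb).
Qed.

Section WeightFour.
Variables (Phi Psi : {vspace R}).
Hypotheses (cap0 : (Phi :&: Psi = 0)%VS) (tsPhi : totally_singular q Phi).
Hypothesis k5 : (5 <= k)%N.

(** If b were nonzero, no coordinate a_i + b could vanish, as Phi and Psi meet trivially, and the
    weight would be at least k, hence at least 5. *)
Lemma calS_weight4 (s : Rk) :
  s \in calS k Phi Psi -> w s = 4%N ->
  forall i, (s : {ffun 'I_k -> R}) i \in Phi.
Proof.
case/(calSP _ cap0)=> a [b [aP bP _ ->]] w4 i; rewrite ffunE.
suff b0 : b = 0 by rewrite b0 addr0.
apply/eqP; apply: contraLR k5 => b0; rewrite -ltnNge -w4.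
rewrite ltnS -{1}(card_ord k) -sum1_card leq_sum // => j _.
rewrite lt0n weight_eq0 ffunE addv_eq0; apply: contra b0 => /eqP ab.
by rewrite -memv0 -cap0 memv_cap bP -ab aP.
Qed.

(** Expresses by weights alone whether s is nonzero in block i. A nonzero s_i is singular and
    already has weight two, so adding z there cannot raise the weight; if s_i = 0 the weight becomes
    5. *)
Lemma weight4_touch (s : Rk) i z :
  s \in calS k Phi Psi -> w s = 4%N -> q z = 1 ->
  (w ((s : {ffun 'I_k -> R}) + at_coord i z)%R <= 4)%N = (s i != 0).
Proof.
move=> sS w4 qz; have := weight_pow_add q (s : {ffun 'I_k -> R}) i z.
have siP := calS_weight4 sS w4 i; rewrite w4.
have [-> | si0] := eqVneq (s i) 0.
  have /eqP-> : weight q 0 == 0%N by rewrite weight_eq0.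
  have /eqP-> : weight q (0 + z) == 1%N by rewrite add0r weight_eq1 // qz.
  by rewrite addn0 => ->.
have /eqP-> : weight q (s i) == 2%N by rewrite weight_eq2 // si0 (tsPhi siP).
move=> E; rewrite -(leq_add2r 2) E leq_add2l weight_le2 //.
Qed.

(** If the two images lay in blocks j and j', a weight-four vector t of [calS] supported on j and a
    third block would meet j but not j'. By [weight4_touch] its preimage s would both meet and miss
    block i. *)
Lemma same_block_calS g i z z' :
  Phi != 0%VS -> g \in 'N_(preservers w)(calS k Phi Psi | 'P)%g ->
  q z = 1 -> q z' = 1 ->
  same_block (g (at_coord i z)) (g (at_coord i z')).
Proof.
move=> Phi0 /setwise_stabP[gw gS] qz qz'.
have [j [y [qy gz]]] := isometry_unit q_quad i gw qz.
have [j' [y' [qy' gz']]] := isometry_unit q_quad i gw qz'.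
exists j, y, y'; split=> //; rewrite gz'; congr (at_coord _ _).
apply/eqP; apply/negPn/negP => j'j; exfalso.
have [l /andP[lj lj']] := third_index j j' (leq_trans (isT : (3 <= 5)%N) k5).
pose a := vpick Phi; have aP : a \in Phi := memv_pick _.
have a0 : a != 0 by rewrite vpick0.
have wa : weight q a = 2%N by apply/eqP; rewrite weight_eq2 // a0 (tsPhi aP).
pose t : Rk := at_coord j a + at_coord l a.
have tS : t \in calS k Phi Psi by apply: calS_pair.
have tw : w t = 4%N by rewrite weight_pow_at2 1?eq_sym // wa.
pose s := (g^-1%g t); have gs : g s = t by rewrite permKV.
have sS : s \in calS k Phi Psi by rewrite -gS gs.
have sw : w s = 4%N by rewrite -(isometryE gw) gs.
have tj : t j != 0 by rewrite ffunE at_coordE at_coordN ?addr0 // eq_sym.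
have tj' : t j' = 0 by rewrite ffunE !at_coordN ?addr0 // eq_sym.
have := weight4_touch j' tS tw qy'; rewrite tj' eqxx.
have -> : w ((t : {ffun 'I_k -> R}) + at_coord j' y') =
          w ((s : {ffun 'I_k -> R}) + at_coord i z').
  by rewrite -gz' -gs -(isometryD gw) (isometryE gw).
rewrite weight4_touch // -(weight4_touch i sS sw qz).
rewrite -(isometryE gw) (isometryD gw) gs gz.
by rewrite (weight4_touch j tS tw qy) tj.
Qed.

End WeightFour.

Hypothesis R_unit : exists z, q z = 1.
Variable A : {group {perm Rk}}.
Hypothesis A_iso : A \subset preservers w.
Hypothesis A_block : forall g i z z', g \in A -> q z = 1 -> q z' = 1 ->
  same_block (g (at_coord i z)) (g (at_coord i z')).

(** Weight-one vectors define f; the work is to show that nonzero singular vectors follow them. *)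
Lemma block_image g : g \in A ->
  exists f : 'I_k -> 'I_k, injective f /\
    forall i a, exists b, g (at_coord i a) = at_coord (f i) b.
Proof.
move=> gA; have gw := subsetP A_iso g gA; have [z0 qz0] := R_unit.
have [f fP] : exists f : 'I_k -> 'I_k,
    forall i, exists z, q z = 1 /\ g (at_coord i z0) = at_coord (f i) z.
  have /fin_all_exists[f fP] :
    forall i, exists j, exists z, q z = 1 /\ g (at_coord i z0) = at_coord j z.
    by move=> i; apply: isometry_unit.
  by exists f.
have f_unit i z : q z = 1 ->
  exists z', q z' = 1 /\ g (at_coord i z) = at_coord (f i) z'.
  move=> qz; have [j [z' [qz' gz]]] := isometry_unit q_quad i gw qz.
  have [y [qy gy]] := fP i; have := A_block i gA qz0 qz.
  rewrite gy gz => /(same_block_index (unit_neq0 q_quad qy) (unit_neq0 q_quad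
    qz')) ->.
  by exists z'.
(* The inverse of g also lies in [A], so images in one block come from one block. *)
have f_sep i j z1 z2 y1 y2 : q z1 = 1 -> q z2 = 1 -> q y1 = 1 -> q y2 = 1 ->
    g (at_coord i z1) = at_coord j y1 ->
      forall i', g (at_coord i' z2) = at_coord j y2 -> i = i'.
  move=> q1 q2 q3 q4 g1 i' g2.
  have := A_block j (groupVr gA) q3 q4; rewrite -g1 -g2 !permK.
  exact: same_block_index (unit_neq0 q_quad q1) (unit_neq0 q_quad q2).
exists f; split=> [i i' fi | i a].
  have [y [qy gy]] := fP i; have [y' [qy' gy']] := fP i'.
  by rewrite -fi in gy'; apply: (f_sep _ _ _ _ _ _ qz0 qz0 qy qy' gy _ gy').
have [a0 | a0] := eqVneq a 0.
  by exists 0; rewrite a0 !at_coord0; apply: isometry0 gw.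
case: (F2_cases (q a)) => qa; last first.
  by have [b [_ gb]] := f_unit i a qa; exists b.
(* Then a + y is again singular and nonzero, so it has weight two; if the images of a and y lay in
   different blocks, the sum would have weight three. *)
have [y [qy ay]] : exists y, q y = 1 /\ polar q a y = 1.
  have [y ya] : exists y, polar q a y = 1.
    have [||y [ya _]] := @nonsingular_pair_split _ q a 0 q_quad q_ns => //.
    by exists y; rewrite polarC.
  case: (F2_cases (q y)) => qy; last by exists y.
  by exists (y + a); rewrite quadD polarDr // polarvv // (polarC q_quad y) qa
    qy ya !(addr0, add0r).
have w2 : w (g (at_coord i a)) = 2%N.
  by rewrite (isometryE gw) weight_pow_at //; apply/eqP;
    rewrite weight_eq2 // a0 qa.
have [y' [qy' gy]] := f_unit i y qy.
have [[j [a' ga]] | [j [l [z1 [z2 [jl q1 q2 ga]]]]]] := weight_pow2 q_quad w2.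
  exists a'; rewrite ga; have [->//|jf] := eqVneq j (f i).
  have : w (g (at_coord i a) + g (at_coord i y) : {ffun 'I_k -> R}) = 2%N.
    rewrite -(isometryD gw) (isometryE gw) -at_coordD weight_pow_at //;
      apply/eqP.
    rewrite weight_eq2 // quadD qa qy ay add0r addF2 eqxx andbT addv_eq0.
    by apply: contra_eq_neq qa => ->; rewrite qy.
  rewrite ga gy weight_pow_at2 // -(weight_pow_at q j) -ga w2.
  by have /eqP-> : weight q y' == 1%N by rewrite weight_eq1 // qy'.
(* Remaining case: the image of a is a sum of weight-one vectors in blocks j and l. Their preimages
   add up to a vector supported on block i, so they share a block, which forces j = l. *)
have gVw := groupVr gw.
have [i1 [z3 [q3 g3]]] := isometry_unit q_quad j gVw q1.
have [i2 [z4 [q4 g4]]] := isometry_unit q_quad l gVw q2.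
have aE : at_coord i a = at_coord i1 z3 + at_coord i2 z4.
  by rewrite -g3 -g4 -(isometryD gVw) -ga permK.
have i12 : i1 = i2.
  apply/eqP; apply: contraTT isT => i12.
  have v1 := congr1 (fun v : {ffun 'I_k -> R} => v i1) aE.
  have v2 := congr1 (fun v : {ffun 'I_k -> R} => v i2) aE.
  have ii1 : i1 = i.
    apply/eqP; apply: contraNT (unit_neq0 q_quad q3) => ii1.
    by move: v1; rewrite !ffunE eqxx (negbTE ii1) (negbTE i12) addr0 => <-.
  have ii2 : i2 = i.
    apply/eqP; apply: contraNT (unit_neq0 q_quad q4) => ii2.
    by move: v2; rewrite !ffunE eqxx (negbTE ii2) eq_sym (negbTE i12) add0r =>
      <-.
  by rewrite ii1 ii2 eqxx in i12.
have := A_block i1 gA q3 q4; rewrite -{1}g3 i12 -g4 !permKV.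
move/(same_block_index (unit_neq0 q_quad q1) (unit_neq0 q_quad q2)) => jl'.
by rewrite jl' eqxx in jl.
Qed.

Lemma monomial g : g \in A ->
  exists h : {ffun 'I_k -> {perm fR}}, exists s : 'S_k,
    (forall i, h i \in preservers q) /\ g = (coordwise h * permcoord R s)%g.
Proof.
move=> gA; have gw := subsetP A_iso g gA.
have [f [f_inj gf]] := block_image gA.
pose h0 i (a : fR) : fR := (g (at_coord i a) : {ffun 'I_k -> R}) (f i).
have gh i a : g (at_coord i a) = at_coord (f i) (h0 i a).
  by rewrite /h0; have [b ->] := gf i a; rewrite at_coordE.
have h0_inj i : injective (h0 i).
  move=> a b ab; apply: (@at_coord_inj _ k i).
  by apply: (@perm_inj _ g); rewrite !gh ab.
exists [ffun i => perm (@h0_inj i)], (perm f_inj); split=> [i|].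
  rewrite ffunE; apply/isometryP; split=> [a b | a]; rewrite !permE.
    apply: (@at_coord_inj _ k (f i)).
    by rewrite at_coordD -!gh at_coordD (isometryD gw).
  apply: (weight_quad q_quad).
  have wh : w (g (at_coord i a)) = weight q (h0 i a) by rewrite gh
    weight_pow_at.
  by apply: etrans (esym wh) _; rewrite (isometryE gw) weight_pow_at.
apply/permP=> v; rewrite permM; apply/ffunP=> j.
rewrite permcoordE coordwiseE ffunE permE.
rewrite -{1}(sum_at_coord (v : {ffun 'I_k -> R})) (isometry_sum gw).
set i := ((perm f_inj)^-1)%g j;
  have fi : f i = j by rewrite -[f i](permE f_inj) permKV.
rewrite sum_ffunE (bigD1 i) //= gh fi at_coordE big1 ?addr0 // => l li.
by rewrite gh at_coordN // -fi (inj_eq f_inj) eq_sym.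
Qed.

End Monomial.

(** * Hyperbolic coordinates on R *)

Section HyperbolicCoordinates.
Variables (m : nat) (R : vectType 'F_2) (q : R -> 'F_2).
Variables (Phi Psi : {vspace R}) (e f : 'I_m -> R).
Hypotheses (q_quad : quadratic_form q) (dimR : \dim {:R} = (2 * m)%N).
Hypotheses (tsPhi : totally_singular q Phi) (tsPsi : totally_singular q Psi).
Hypotheses (e_in : forall i, e i \in Phi) (f_in : forall i, f i \in Psi).
Hypothesis ef_dual : forall i j, polar q (e i) (f j) = (i == j)%:R.
Local Notation fR := (finvect_type R).
Implicit Types (a b r : R) (x y : 'rV['F_2]_m).

Definition comb x y : R := \sum_i x 0 i *: e i + \sum_i y 0 i *: f i.
Definition xcoord r : 'rV['F_2]_m := \row_i polar q r (f i).
Definition ycoord r : 'rV['F_2]_m := \row_i polar q r (e i).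

Lemma xcoordD a b : xcoord (a + b) = xcoord a + xcoord b.
Proof. by apply/rowP=> i; rewrite !mxE polarDl. Qed.

Lemma ycoordD a b : ycoord (a + b) = ycoord a + ycoord b.
Proof. by apply/rowP=> i; rewrite !mxE polarDl. Qed.

Lemma combD x1 y1 x2 y2 : comb (x1 + x2) (y1 + y2) = comb x1 y1 + comb x2 y2.
Proof.
rewrite /comb addrACA; congr (_ + _); rewrite -big_split /=.
  by apply: eq_bigr => i _; rewrite mxE scalerDl.
by apply: eq_bigr => i _; rewrite mxE scalerDl.
Qed.

Lemma sum_e_in x : \sum_i x 0 i *: e i \in Phi.
Proof. by apply: rpred_sum => i _; apply: rpredZ. Qed.

Lemma sum_f_in y : \sum_i y 0 i *: f i \in Psi.
Proof. by apply: rpred_sum => i _; apply: rpredZ. Qed.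

Lemma combK x y : xcoord (comb x y) = x /\ ycoord (comb x y) = y.
Proof.
split; apply/rowP=> i; rewrite mxE polarDl //.
  rewrite (totally_singular_polar tsPsi (sum_f_in y)) // addr0.
  rewrite polar_suml // (bigD1 i) //= big1 => [|j ji];
    rewrite polarZl // ef_dual.
    by rewrite eqxx mulr1 addr0.
  by rewrite (negbTE ji) mulr0.
rewrite (totally_singular_polar tsPhi (sum_e_in x)) // add0r.
rewrite polar_suml // (bigD1 i) //= big1 => [|j ji];
  rewrite polarZl // polarC // ef_dual.
  by rewrite eqxx mulr1 addr0.
by rewrite eq_sym (negbTE ji) mulr0.
Qed.

Lemma xcoordK x y : xcoord (comb x y) = x. Proof. by case: (combK x y). Qed.
Lemma ycoordK x y : ycoord (comb x y) = y. Proof. by case: (combK x y). Qed.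

(* Injectivity of [comb] and [#|R| = 2 ^ (2 * m)] make it surjective. *)
Lemma coordK r : comb (xcoord r) (ycoord r) = r.
Proof.
pose c (p : 'rV['F_2]_m * 'rV['F_2]_m) : fR := comb p.1 p.2.
pose d (r : fR) := (xcoord r, ycoord r).
have cK : cancel c d by case=> x y; rewrite /d xcoordK ycoordK.
have [d' cK' d'K] : bijective c.
  apply: inj_card_bij (can_inj cK) _.
  by rewrite card_finvect dimR card_prod !card_mx card_Fp // mul1n -expnD addnn
    mul2n.
have dE : d' r = d r by rewrite -{2}(d'K r) cK.
by have := d'K r; rewrite dE.
Qed.

Lemma coord_inj a b : xcoord a = xcoord b -> ycoord a = ycoord b -> a = b.
Proof. by move=> ab1 ab2; rewrite -(coordK a) ab1 ab2 coordK. Qed.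

Lemma memPhi r : (r \in Phi) = (ycoord r == 0).
Proof.
apply/idP/eqP => [rP | y0].
  by apply/rowP=> i; rewrite !mxE (totally_singular_polar tsPhi).
rewrite -(coordK r) y0 /comb rpredD ?sum_e_in //.
by rewrite big1 ?rpred0 // => i _; rewrite mxE scale0r.
Qed.

Lemma memPsi r : (r \in Psi) = (xcoord r == 0).
Proof.
apply/idP/eqP => [rP | x0].
  by apply/rowP=> i; rewrite !mxE (totally_singular_polar tsPsi).
rewrite -(coordK r) x0 /comb rpredD ?sum_f_in //.
by rewrite big1 ?rpred0 // => i _; rewrite mxE scale0r.
Qed.

Lemma memPhiE r : r \in Phi -> r = comb (xcoord r) 0.
Proof. by rewrite memPhi => /eqP <-; rewrite coordK. Qed.

Lemma comb_Phi x : comb x 0 \in Phi.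
Proof. by rewrite memPhi ycoordK. Qed.

Lemma comb_Psi y : comb 0 y \in Psi.
Proof. by rewrite memPsi xcoordK. Qed.

Lemma comb0 : comb 0 0 = 0.
Proof. by apply: (@addIr _ (comb 0 0)); rewrite -combD !add0r. Qed.

Lemma comb_split x y : comb x y = comb x 0 + comb 0 y.
Proof. by rewrite -combD addr0 add0r. Qed.

Lemma polar_comb x1 y1 x2 y2 :
  polar q (comb x1 y1) (comb x2 y2) = (x1 *m y2^T + y1 *m x2^T) 0 0.
Proof.
rewrite {2}/comb polarDr // addrC !polar_sumr // !mxE; congr (_ + _).
  apply: eq_bigr => i _; rewrite polarZr // mxE mulrC; congr (_ * _).
  by have := congr1 (fun z : 'rV_m => z 0 i) (xcoordK x1 y1); rewrite mxE.
apply: eq_bigr => i _; rewrite polarZr // mxE mulrC; congr (_ * _).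
by have := congr1 (fun z : 'rV_m => z 0 i) (ycoordK x1 y1); rewrite mxE.
Qed.

Lemma quad_comb x y : q (comb x y) = (x *m y^T) 0 0.
Proof.
rewrite comb_split quadD // (tsPhi (comb_Phi x)) (tsPsi (comb_Psi y)) !add0r.
by rewrite polar_comb mul0mx addr0.
Qed.

Lemma perp_Phi r : (forall a, a \in Phi -> polar q r a = 0) -> r \in Phi.
Proof. by move=> rP; rewrite memPhi; apply/eqP/rowP=> i; rewrite !mxE rP. Qed.

Lemma capPhiPsi r : r \in Phi -> r \in Psi -> r = 0.
Proof.
rewrite memPhi memPsi => /eqP y0 /eqP x0; rewrite -(coordK r) x0 y0 /comb.
by rewrite !big1 ?addr0 // => i _; rewrite mxE scale0r.
Qed.

Lemma decompose r : exists a b, [/\ a \in Phi, b \in Psi & r = a + b].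
Proof.
exists (comb (xcoord r) 0), (comb 0 (ycoord r)); rewrite comb_Phi comb_Psi.
by rewrite -comb_split coordK.
Qed.

(** * The stabilizer of Phi: its subgroups U and K *)

Local Notation O := (preservers q).
Local Notation H := ('N_O(vset Phi | 'P))%g.
Local Notation U := ('C_O(vset Phi | 'P))%g.
Local Notation K := ('N_H(vset Psi | 'P))%g.
Implicit Types (g u : {perm fR}) (E : {set {set 'I_m}}).

Lemma stabPhiP g :
  reflect (g \in O /\ forall v : R, (g v \in Phi) = (v \in Phi)) (g \in H).
Proof.
apply: (iffP (setwise_stabP _ _ _)) => [] [gO gP]; split=> // v.
  by have := gP v; rewrite !inE.
by rewrite !inE gP.
Qed.

Lemma fixPhiP g :
  reflect (g \in O /\ forall v : R, v \in Phi -> g v = v) (g \in U).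
Proof.
apply: (iffP (pointwise_stabP _ _ _)) => [] [gO gP]; split=> // v.
  by move=> vP; apply: gP; rewrite inE.
by rewrite inE; apply: gP.
Qed.

Lemma stabPhiPsiP g :
  reflect [/\ g \in O, forall v : R, (g v \in Phi) = (v \in Phi)
            & forall v : R, (g v \in Psi) = (v \in Psi)] (g \in K).
Proof.
apply: (iffP (setwise_stabP _ _ _)) => [[/stabPhiP[gO gP] gQ] | [gO gP gQ]].
  by split=> // v; have := gQ v; rewrite !inE.
by split=> [|v]; [apply/stabPhiP | rewrite !inE gQ].
Qed.

(** As u is an isometry fixing Phi pointwise, r and u r have the same products with Phi; and Phi
    contains everything orthogonal to it. *)
Lemma fixPhi_move u r : u \in U -> r + u r \in Phi.
Proof.
case/fixPhiP=> uO uP; apply: perp_Phi => a aP.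
by rewrite polarDl // -{2}(uP a aP) (isometry_polar _ _ uO) addF2.
Qed.

(** The displacement r + u r lies in Phi, so g fixes it. Products in U thus become sums of
    displacements, which is why U is abelian of exponent two. *)
Lemma fixPhi_mul u g r : u \in U -> g \in U ->
  r + (u * g)%g r = (r + u r) + (r + g r).
Proof.
move=> uU gU; have [gO gP] := fixPhiP _ gU; rewrite permM.
have ur : u r = r + (r + u r) by rewrite addrA addvv add0r.
have sP := fixPhi_move r uU; move: (r + u r) ur sP => s -> sP.
by rewrite (isometryD gO) (gP s sP) addrA addrC.
Qed.

Lemma fixPhi_prod (I : Type) (s : seq I) (P : pred I) (h : I -> {perm fR}) r :
  (forall i, P i -> h i \in U) ->
  r + (\prod_(i <- s | P i) h i)%g r = \sum_(i <- s | P i) (r + h i r).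
Proof.
move=> hU; elim: s => [|i s IHs]; first by rewrite !big_nil perm1 addvv.
rewrite !big_cons; case: ifP => // Pi.
by rewrite fixPhi_mul ?IHs ?hU //; apply: group_prod.
Qed.

Lemma fixPhi_eq u g : (forall r : R, r + u r = r + g r) -> u = g.
Proof. by move=> ug; apply/permP=> r; apply: (addrI r); apply: ug. Qed.

Lemma fixPhi_abelem : (2.-abelem U)%g.
Proof.
apply/abelemP=> //; split=> [|u uU].
  apply/centsP=> u uU g gU; apply: fixPhi_eq => r.
  by rewrite !fixPhi_mul // addrC.
by apply: fixPhi_eq => r; rewrite expgS expg1 fixPhi_mul // addvv perm1 addvv.
Qed.

(** A set E of unordered pairs encodes a symmetric matrix with zero diagonal, i.e. an alternating
    matrix over F_2; this makes the count 2^C(m,2) a power set cardinality. *)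
Definition pairs : {set {set 'I_m}} := [set A : {set 'I_m} | #|A| == 2].
Definition pairs_mx E : 'M['F_2]_m := \matrix_(i, j) ([set i; j] \in E)%:R.
Definition shift E r : fR := r + comb (ycoord r *m pairs_mx E) 0.

Lemma ycoord_shift E r : ycoord (shift E r) = ycoord r.
Proof. by rewrite ycoordD ycoordK addr0. Qed.

Lemma shift_inj E : injective (shift E).
Proof.
apply: (can_inj (g := shift E)) => r.
by rewrite {1}/shift ycoord_shift /shift addvK.
Qed.

Lemma pairs_mx_quad E (y : 'rV_m) :
  E \subset pairs -> (y *m (pairs_mx E)^T *m y^T) 0 0 = 0.
Proof.
move=> sE; rewrite mxE.
transitivity (\sum_j \sum_i y 0 i * y 0 j * ([set j; i] \in E)%:R).
  apply: eq_bigr => j _; rewrite mxE mulr_suml; apply: eq_bigr => i _.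
  by rewrite !mxE mulrAC.
pose c j i := y 0 i * y 0 j * ([set j; i] \in E)%:R.
rewrite (@sum_symmetric_F2 _ c) => [|i j];
  last by rewrite /c setUC (mulrC (y 0 j)).
rewrite big1 // => i _; rewrite /c;
  case: (boolP (_ \in E)) => [/(subsetP sE)|]; last by rewrite mulr0.
by rewrite inE setUid cards1.
Qed.

Lemma shift_fixPhi E : E \subset pairs -> perm (@shift_inj E) \in U.
Proof.
move=> sE; apply/fixPhiP; split=> [|v]; last first.
  rewrite memPhi permE /shift => /eqP->.
  by rewrite mul0mx comb0 addr0.
apply/isometryP; split=> [a b|v]; rewrite !permE /shift.
  by rewrite ycoordD mulmxDl -[X in comb _ X]addr0 combD addrACA.
rewrite quadD (tsPhi (comb_Phi _)) addr0 -{2}(coordK v) polar_comb trmx0 mulmx0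
  add0r.
by rewrite trmx_mul mulmxA pairs_mx_quad // addr0.
Qed.

Lemma ycoord_f j : ycoord (f j) = delta_mx 0 j.
Proof.
by apply/rowP=> i; rewrite !mxE polarC // ef_dual eqxx andTb.
Qed.

(** The matrix of u is [c], the products of the u f_j with the f_i. It has zero diagonal because f_i
    + u f_i is singular, and it is symmetric because the displacements of f_i and f_j are
    orthogonal. *)
Lemma fixPhi_shift u :
  u \in U -> exists2 E : {set {set 'I_m}}, E \subset pairs &
    u = perm (@shift_inj E).
Proof.
move=> uU; have [uO uP] := fixPhiP _ uU.
pose c i j := polar q (u (f j)) (f i).
have f0 i j : polar q (f i) (f j) = 0 by rewrite (totally_singular_polar tsPsi).
have cii i : c i i = 0.
  have := tsPhi (fixPhi_move (f i) uU).
  by rewrite quadD (isometryE uO) addF2 add0r polarC.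
have cC i j : c i j = c j i.
  have p0 := totally_singular_polar tsPhi.
  have := p0 _ _ (fixPhi_move (f i) uU) (fixPhi_move (f j) uU).
  rewrite polarDl // !polarDr // f0 (isometry_polar _ _ uO) f0 add0r addr0.
  by rewrite polarC // => /addF2_eq0.
pose E := [set A in pairs | [exists i, exists j,
             (A == [set i; j]) && (c i j == 1)]].
have cE i j : ([set i; j] \in E)%:R = c i j.
  rewrite !inE cards2; have [-> /=|ij /=] := eqVneq i j; first by rewrite cii.
  case: existsP => [[i' /existsP[j' /andP[/eqP eA /eqP c1]]]|nE] /=.
    have /set2P i_in : i \in [set i'; j'] by rewrite -eA set21.
    have /set2P j_in : j \in [set i'; j'] by rewrite -eA set22.
    by case: i_in j_in ij => -> [] ->; rewrite ?eqxx ?c1 // cC c1.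
  case: (F2_cases (c i j)) => // c1; case: nE.
  by exists i; apply/existsP; exists j; rewrite c1 !eqxx.
exists E; first by apply/subsetP=> A; rewrite inE => /andP[].
apply/permP=> r; rewrite permE /shift.
have yu : ycoord (u r) = ycoord r.
  have := fixPhi_move r uU; rewrite memPhi ycoordD addv_eq0 => /eqP->//.
apply: coord_inj; last by rewrite ycoordD ycoordK addr0.
rewrite xcoordD xcoordK; apply/rowP=> i; rewrite !mxE.
rewrite -{1}(coordK r) comb_split (isometryD uO) (uP _ (comb_Phi _)) polarDl //.
congr (_ + _).
  by have := xcoordK (xcoord r) 0 => /rowP/(_ i); rewrite !mxE.
have -> : comb 0 (ycoord r) = \sum_j ycoord r 0 j *: f j.
  by rewrite /comb big1 ?add0r // => j _; rewrite mxE scale0r.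
rewrite (isometry_sum uO) polar_suml //; apply: eq_bigr => j _.
by rewrite (isometryZ uO) polarZl // [pairs_mx _ _ _]mxE setUC cE.
Qed.

Lemma card_fixPhi : #|U| = (2 ^ 'C(m, 2))%N.
Proof.
have -> : U = [set perm (@shift_inj E) | E in powerset pairs].
  apply/setP=> u; apply/idP/imsetP => [/fixPhi_shift[E sE ->]|[E]].
    by exists E; rewrite // powersetE.
  by rewrite powersetE => sE ->; apply: shift_fixPhi.
rewrite card_in_imset ?card_powerset ?card_draws ?card_ord //.
move=> E F; rewrite !powersetE => sE sF /permP EF; apply/setP=> A.
have [|nA] := boolP (A \in pairs); last first.
  by rewrite (contraNF (subsetP sE A) nA) (contraNF (subsetP sF A) nA).
rewrite inE => /cards2P[i [j [ij ->]]].
have := EF (f i); rewrite !permE => /addrI/(congr1 xcoord).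
rewrite !xcoordK ycoord_f -!rowE => /rowP/(_ j); rewrite !mxE.
by do 2!case: (_ \in _).
Qed.

(** The inverse transpose on y is what keeps x . y, hence q, unchanged. *)
Definition lift_mx (A : 'M['F_2]_m) r : fR :=
  comb (xcoord r *m A) (ycoord r *m (invmx A)^T).

Lemma lift_mxM (A B : 'M_m) r : A \in unitmx -> B \in unitmx ->
  lift_mx B (lift_mx A r) = lift_mx (A *m B) r.
Proof.
move=> uA uB; have AB1 : invmx (A *m B) = invmx B *m invmx A.
  apply: (can_inj (mulmxK (_ : A *m B \in unitmx)));
    first by rewrite unitmx_mul uA.
  by rewrite mulVmx ?unitmx_mul ?uA // -mulmxA mulKmx ?mulVmx.
by rewrite /lift_mx xcoordK ycoordK AB1 trmx_mul !mulmxA.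
Qed.

Lemma lift_mx1 r : lift_mx 1%:M r = r.
Proof. by rewrite /lift_mx invmx1 trmx1 !mulmx1 coordK. Qed.

Lemma lift_mx_inj (A : 'M_m) : A \in unitmx -> injective (lift_mx A).
Proof.
move=> uA; apply: (can_inj (g := lift_mx (invmx A))) => r.
by rewrite lift_mxM ?unitmx_inv // mulmxV // lift_mx1.
Qed.

Lemma lift_mx_Phi (A : 'M_m) r : r \in Phi ->
  lift_mx A r = comb (xcoord r *m A) 0.
Proof. by rewrite /lift_mx memPhi => /eqP->; rewrite mul0mx. Qed.

Definition lift_perm A (uA : A \in unitmx) : {perm fR} := perm (lift_mx_inj uA).

Lemma lift_perm_stab A (uA : A \in unitmx) : lift_perm uA \in K.
Proof.
apply/stabPhiPsiP; split=> [|v|v]; last 2 first.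
- rewrite permE !memPhi ycoordK mulmx_free_eq0 // row_free_unit.
  by rewrite unitmx_tr unitmx_inv.
- by rewrite permE !memPsi xcoordK mulmx_free_eq0 // row_free_unit.
apply/isometryP; split=> [a b | v]; rewrite !permE /lift_mx.
  by rewrite xcoordD ycoordD !mulmxDl combD.
rewrite quad_comb -{3}(coordK v) quad_comb trmx_mul trmxK mulmxA.
by rewrite -(mulmxA _ A) mulmxV // mulmx1.
Qed.

(** For b in Psi the displacement b + g b lies in Phi and in Psi, hence is 0. *)
Lemma stab_trivIset g : g \in U -> g \in K -> g = 1%g.
Proof.
move=> gU /stabPhiPsiP[gO gP gQ]; apply/permP=> r; rewrite perm1.
have [_ gfix] := fixPhiP _ gU.
have [a [b [aP bQ ->]]] := decompose r; rewrite (isometryD gO) gfix //.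
congr (_ + _); apply/eqP; rewrite eq_sym -addv_eq0; apply/eqP.
by apply: capPhiPsi; [apply: fixPhi_move | rewrite rpredD ?gQ].
Qed.

Lemma stabPhi_mx g : g \in H ->
  exists A, exists uA : A \in unitmx, forall v : R, v \in Phi ->
    g v = lift_perm uA v.
Proof.
case/stabPhiP=> gO gP; pose A := \matrix_i xcoord (g (e i)).
have gA v : v \in Phi -> g v = comb (xcoord v *m A) 0.
  move=> vP; have : g v \in Phi by rewrite gP.
  move/memPhiE->; congr (comb _ _); apply/rowP=> j; rewrite !mxE.
  rewrite {1}(memPhiE vP) /comb [X in _ + X]big1 ?addr0 => [|i _]; last first.
    by rewrite mxE scale0r.
  rewrite (isometry_sum gO) polar_suml //; apply: eq_bigr => i _.
  by rewrite (isometryZ gO) polarZl // !mxE.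
have uA : A \in unitmx.
  rewrite -row_free_unit -kermx_eq0; apply/rowV0P=> x /sub_kermxP xA.
  have := gA _ (comb_Phi x); rewrite xcoordK xA comb0 => gx0.
  have x0 : comb x 0 = 0 by apply: (@perm_inj _ g); rewrite gx0 (isometry0 gO).
  by rewrite -(xcoordK x 0) x0 -comb0 xcoordK.
exists A, uA => v vP; rewrite gA // permE lift_mx_Phi //.
Qed.

Lemma stabPhi_decompose g : g \in H ->
  exists A, exists uA : A \in unitmx, (g * (lift_perm uA)^-1)%g \in U.
Proof.
move=> gH; have [A [uA gA]] := stabPhi_mx gH; exists A, uA.
have [gO _] := stabPhiP _ gH;
  have [lO _ _] := stabPhiPsiP _ (lift_perm_stab uA).
apply/fixPhiP; split=> [|v vP]; first by rewrite groupM ?groupV.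
by rewrite permM gA // permK.
Qed.

Lemma stabPhiPsi_lift g : g \in K ->
  exists A, exists uA : A \in unitmx, g = lift_perm uA.
Proof.
move=> gK; have gH : g \in H by case/setIP: gK.
have [A [uA gA]] := stabPhi_decompose gH; exists A, uA.
apply/eqP; rewrite -(can_eq (mulgK (lift_perm uA)^-1%g)) mulgV; apply/eqP.
by apply: (stab_trivIset gA); rewrite groupM ?groupV ?lift_perm_stab.
Qed.

(** A nonzero row has rank one, so Gaussian elimination carries it to the first unit row; the 1 by 1
    column factor is invertible over F_2, hence equal to 1. *)
Lemma row_transitive (x y : 'rV['F_2]_m) : x != 0 -> y != 0 ->
  exists2 A, A \in unitmx & x *m A = y.
Proof.
have base (z : 'rV['F_2]_m) : z != 0 -> z = pid_mx 1 *m row_ebase z.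
  move=> z0; have rz : \rank z = 1%N by apply/eqP;
    rewrite eqn_leq rank_leq_row lt0n mxrank_eq0.
  rewrite -{1}(mulmx_ebase z) rz; congr (_ *m _); rewrite -[RHS]mul1mx;
    congr (_ *m _).
  rewrite [col_ebase z]mx11_scalar; congr (_%:M).
  apply: F2_neq0; have := col_ebase_unit z; rewrite unitmxE det_mx11 unitfE //.
move=> /base xE /base yE; exists (invmx (row_ebase x) *m row_ebase y).
  by rewrite unitmx_mul unitmx_inv !row_ebase_unit.
by rewrite {1}xE mulmxA mulmxK ?row_ebase_unit // -yE.
Qed.

Lemma stab_transitive (a b : R) : a \in Phi -> b \in Phi -> a != 0 -> b != 0 ->
  exists2 g, g \in K & g a = b.
Proof.
move=> aP bP a0 b0.
have x0 r : r \in Phi -> r != 0 -> xcoord r != 0.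
  by move=> rP; apply: contra_neq => xr; rewrite (memPhiE rP) xr comb0.
have [A uA xA] := row_transitive (x0 _ aP a0) (x0 _ bP b0).
exists (lift_perm uA); first exact: lift_perm_stab.
by rewrite permE lift_mx_Phi // xA -memPhiE.
Qed.

Lemma card_Phi : #|vset Phi| = (2 ^ m)%N.
Proof.
have -> : vset Phi = [set (comb x 0 : fR) | x in [set: 'rV['F_2]_m]].
  apply/setP=> r; rewrite inE; apply/idP/imsetP => [rP | [x _ ->]].
    by exists (xcoord r); rewrite // -memPhiE.
  exact: comb_Phi.
rewrite card_imset; first by rewrite cardsT card_mx card_Fp // mul1n.
by move=> x y /(congr1 xcoord); rewrite !xcoordK.
Qed.

Lemma fixPhi_normal : (U <| H)%g.
Proof.
apply/andP; split; apply/subsetP=> g.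
  case/fixPhiP=> gO gP; apply/stabPhiP; split=> // v.
  apply/idP/idP => [gvP|vP]; last by rewrite gP.
  by rewrite -(perm_inj (gP _ gvP)).
case/stabPhiP=> gO gP; rewrite inE; apply/subsetP=> _ /imsetP[u uU ->].
have [uO uP] := fixPhiP _ uU; apply/fixPhiP; split=> [|v vP].
  by rewrite groupJ.
by rewrite conjgE !permM uP ?permKV // -gP permKV.
Qed.

(* A 2-group acting on [Phi] fixes a nonzero vector, since [#|Phi|] is even;  *)
(* as [H] is transitive on nonzero vectors, the normal subgroup ['O_2(H)] fixes *)
(* them all.                                                                    *)
Lemma pcore_stabPhi : (0 < m)%N -> 'O_2(H)%g = U.
Proof.
move=> m0; apply/eqP; rewrite eqEsubset pcore_max ?fixPhi_normal ?andbT //;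
  last first.
  exact: abelem_pgroup fixPhi_abelem.
have sPH : ('O_2(H) \subset H)%g := pcore_sub _ _.
have actsP : [acts 'O_2(H), on vset Phi | 'P]%g.
  by apply: subset_trans sPH _; apply: subsetIr.
have := pgroup_fix_mod (pcore_pgroup 2%N H) actsP; rewrite card_Phi.
rewrite -(prednK m0) expnS mulnC modnMl => /esym/eqP fix_even.
have [v vfix v0] : exists2 v : fR,
    v \in 'Fix_(vset Phi | 'P)('O_2(H))%g & v != 0 :> R.
  apply/exists_inP; apply: contraLR fix_even => /exists_inPn fix0.
  rewrite (_ : 'Fix_(_ | _)(_) = [set (0 : fR)])%g ?cards1 //.
  apply/setP=> v; rewrite inE; apply/idP/eqP => [/fix0/negPn/eqP//|->].
  apply/setIP; split; first by rewrite inE rpred0.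
  apply/afixP=> g /(subsetP sPH)/stabPhiP[gO _]; exact: isometry0 gO.
have [vP /afixP vfixP] := setIP vfix; rewrite inE in vP.
apply/subsetP=> p pP; have /stabPhiP[pO _] := subsetP sPH _ pP.
apply/fixPhiP; split=> // b bP.
have [->|b0] := eqVneq b 0; first exact: isometry0 pO.
have [g gK <-] := stab_transitive vP bP v0 b0.
have gH : g \in H by case/setIP: gK.
have /vfixP : (p ^ g^-1)%g \in 'O_2(H)%g.
  by rewrite memJ_norm // groupV (subsetP (normal_norm (pcore_normal _ _))).
rewrite /= apermE conjgE invgK !permM => /(congr1 g); rewrite permKV //.
Qed.

(** * Coordinatewise maps stabilizing [calS] *)

Variable k : nat.
Hypotheses (m_gt0 : (0 < m)%N) (k_ge3 : (3 <= k)%N).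
Local Notation Rk := (finvect_type {ffun 'I_k -> R}).
Local Notation w := (@weight_pow R q k).
Local Notation S := (calS k Phi Psi).
Local Notation G := ('N_(preservers w)(S | 'P))%g.
Implicit Types (h : {ffun 'I_k -> {perm fR}}) (s : 'S_k).

Lemma capPP : (Phi :&: Psi = 0)%VS.
Proof.
apply/eqP; rewrite -subv0; apply/subvP=> v /memv_capP[vP vQ].
by rewrite memv0; apply/eqP/capPhiPsi.
Qed.

Lemma coordwise_iso h : (forall i, h i \in preservers q) ->
  coordwise h \in preservers w.
Proof.
move=> hO; apply/isometryP; split=> [u v | v].
  by apply/ffunP=> i; rewrite coordwiseE !ffunE !coordwiseE (isometryD (hO i)).
apply: eq_bigr => i _; rewrite coordwiseE /weight (isometryE (hO i)).
rewrite (_ : (h i (v i) == 0) = (v i == 0)) //; apply/eqP/eqP => [hv|->].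
  by apply: (@perm_inj _ (h i)); rewrite hv (isometry0 (hO i)).
exact: isometry0 (hO i).
Qed.

Lemma permcoord_iso s : permcoord R s \in preservers w.
Proof.
apply/isometryP; split=> [u v | v].
  by apply/ffunP=> i; rewrite permcoordE !ffunE !permcoordE.
rewrite /weight_pow (reindex_inj (@perm_inj _ s)) /=.
by apply: eq_bigr => i _; rewrite permcoordE permK.
Qed.

Lemma permcoord_stabS s : permcoord R s \in G.
Proof.
apply: (setwise_stab_sub (permcoord_iso s)) => v /(calSP _ capPP)[a [b [aP bP
  a0 ->]]].
apply/(calSP _ capPP); exists [ffun i => a ((s^-1)%g i)], b; split=> //.
- by move=> i; rewrite ffunE.
- rewrite (reindex_inj (@perm_inj _ s)) -[RHS]a0.
  by apply: eq_bigr => i _; rewrite ffunE permK.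
- by apply/ffunP=> i; rewrite permcoordE !ffunE.
Qed.

Lemma diag_stabS g : g \in K -> coordwise [ffun=> g] \in G.
Proof.
case/stabPhiPsiP=> gO gP gQ; apply: setwise_stab_sub.
  by apply: coordwise_iso => i; rewrite ffunE.
move=> v /(calSP _ capPP)[a [b [aP bP a0 ->]]].
apply/(calSP _ capPP); exists [ffun i => g (a i)], (g b); split.
- by move=> i; rewrite ffunE gP.
- by rewrite gQ.
- rewrite -[RHS](isometry0 gO) -[X in _ = g X]a0 (isometry_sum gO).
  by apply: eq_bigr => i _; rewrite ffunE.
- by apply/ffunP=> i; rewrite coordwiseE !ffunE (isometryD gO).
Qed.

(* [\sum_i (r + h i r) = 0] for all [r] says that the [h i] multiply to [1]: on *)
(* the abelian group [U], [u |-> (r |-> r + u r)] is additive.                  *)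
Definition balanced : {set {ffun 'I_k -> {perm fR}}} :=
  [set h : {ffun 'I_k -> {perm fR}} | [forall i, h i \in U]
     && [forall r : fR, \sum_i ((r : R) + h i r) == 0]].

Lemma balancedP h :
  reflect ((forall i, h i \in U) /\ forall r : R, \sum_i (r + h i r) = 0)
          (h \in balanced).
Proof.
rewrite inE; apply: (iffP andP) => [[/forallP hU /forallP h0] | [hU h0]].
  by split=> // r; apply/eqP/h0.
by split; apply/forallP => // r; rewrite h0.
Qed.

Definition balanced_sub : {set {perm Rk}} := [set coordwise h | h in balanced].
Local Notation N := balanced_sub.

Lemma balanced_group_set : group_set N.
Proof.
apply/group_setP; split=> [|_ _ /imsetP[u uB ->] /imsetP[v vB ->]].
  apply/imsetP; exists [ffun=> 1%g]; last by rewrite coordwise1.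
  apply/balancedP; split=> [i | r]; first by rewrite ffunE.
  by rewrite big1 // => i _; rewrite ffunE perm1 addvv.
have [uU u0] := balancedP _ uB; have [vU v0] := balancedP _ vB.
apply/imsetP; exists [ffun i => (u i * v i)%g]; last by rewrite coordwiseM.
apply/balancedP; split=> [i | r]; first by rewrite ffunE groupM ?uU ?vU.
rewrite (eq_bigr (fun i => (r + u i r) + (r + v i r))) => [|i _]; last first.
  by rewrite ffunE (fixPhi_mul _ (uU i) (vU i)).
by rewrite big_split /= u0 v0 addr0.
Qed.

Canonical balanced_group := Group balanced_group_set.

(** Coordinate i of the image is a_i + (b + h_i b) + b: the correction lies in Phi, and balance
    makes the corrections sum to 0. *)
Lemma balanced_stabS h : h \in balanced -> coordwise h \in G.
Proof.
case/balancedP=> hU h0; have hO i : h i \in O by case/setIP: (hU i).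
apply: (setwise_stab_sub (coordwise_iso hO)) => v /(calSP _ capPP)[a [b [aP bP
  a0 ->]]].
apply/(calSP _ capPP); exists [ffun i => a i + (b + h i b)], b; split=> //.
- by move=> i; rewrite ffunE rpredD ?fixPhi_move.
- transitivity (\sum_i a i + \sum_i (b + h i b)); last by rewrite a0 h0 addr0.
  by rewrite -big_split; apply: eq_bigr => i _; rewrite ffunE.
- apply/ffunP=> i; rewrite coordwiseE !ffunE (isometryD (hO i)).
  have [_ hP] := fixPhiP _ (hU i); rewrite hP // -addrA; congr (_ + _).
  by rewrite addrC addrA addvv add0r.
Qed.

(** The vectors (a, a) in two blocks show that the h_i preserve Phi and agree on it. Dividing by the
    element g of K with the same action on Phi leaves elements of U, and the constant vectors of Psi
    show that these are balanced. *)
Lemma coordwise_stabS h : (forall i, h i \in preservers q) ->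
  coordwise h \in G ->
  exists (u : {ffun 'I_k -> {perm fR}}) (g : {perm fR}),
    [/\ u \in balanced, g \in K
                & coordwise h = (coordwise u * coordwise [ffun=> g])%g].
Proof.
move=> hO hG; have [_ hS] := setwise_stabP _ _ _ hG.
have hS' v : v \in S -> coordwise h v \in S by rewrite hS.
have pairP i j a : i != j -> a \in Phi -> h i a \in Phi /\ h i a = h j a.
  move=> ij aP; have := hS' _ (calS_pair i j capPP aP).
  case/(calSP _ capPP)=> a' [b' [a'P b'P a'0 /ffunP eq]].
  have [l /andP[li lj]] := third_index i j k_ge3.
  have val (x : 'I_k) :
      h x ((at_coord i a + at_coord j a : {ffun 'I_k -> R}) x) = a' x + b'.
    by rewrite -[LHS]coordwiseE eq ffunE.
  (* In the third block l the image is 0, so b' = a'_l lies in both Phi and Psi. *)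
  have b'0 : b' = 0.
    have := val l; rewrite ffunE !at_coordN // addr0 (isometry0 (hO l)).
    move/eqP; rewrite eq_sym addv_eq0 => /eqP a'b'.
    by apply: capPhiPsi => //; rewrite -a'b'.
  have hi : h i a = a' i.
    by have := val i; rewrite ffunE at_coordE at_coordN // b'0 !addr0.
  have hj : h j a = a' j.
    by have := val j; rewrite ffunE at_coordE at_coordN 1?eq_sym // b'0 addr0
      add0r.
  split; first by rewrite hi.
  apply/eqP; rewrite -addv_eq0 hi hj -a'0 (bigD1 i) //= (bigD1 j) 1?eq_sym //=.
  rewrite big1 ?addr0 // => x /andP[xi xj].
  have := val x; rewrite ffunE !at_coordN // b'0 !addr0 => <-.
  exact: isometry0 (hO x).
pose i0 := Ordinal (leq_trans (isT : (0 < 3)%N) k_ge3).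
have hP a : a \in Phi -> h i0 a \in Phi.
  move=> aP; have [l /andP[li _]] := third_index i0 i0 k_ge3.
  by rewrite eq_sym in li; case: (pairP i0 l a li aP).
have hE i a : a \in Phi -> h i a = h i0 a.
  by have [->//|ii0] := eqVneq i i0 => /(pairP _ _ _ ii0)[].
have h0H : h i0 \in H.
  by apply: setwise_stab_sub => // a; rewrite !inE; apply: hP.
have [A [uA gU]] := stabPhi_decompose h0H.
pose g := lift_perm uA; have gK : g \in K := lift_perm_stab uA.
have [gO _ _] := stabPhiPsiP _ gK.
pose u := [ffun i => (h i * g^-1)%g] : {ffun 'I_k -> {perm fR}}.
have uU i : u i \in U.
  rewrite ffunE; apply/fixPhiP; split=> [|a aP];
    first by rewrite groupM ?groupV.
  have [_ /(_ a aP)] := fixPhiP _ gU.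
  by rewrite !permM hE.
have hug : coordwise h = (coordwise u * coordwise [ffun=> g])%g.
  rewrite -coordwiseM; congr coordwise; apply/ffunP=> i.
  by rewrite !ffunE mulgKV.
exists u, g; split=> //; apply/balancedP; split=> // r.
have uG : coordwise u \in G.
  by rewrite -(mulgK (coordwise [ffun=> g]) (coordwise u)) -hug groupM ?groupV
    ?diag_stabS.
have [_ uS] := setwise_stabP _ _ _ uG.
have [a [b [aP bQ ->]]] := decompose r.
have bS : ([ffun=> b] : Rk) \in S.
  apply/(calSP _ capPP); exists 0, b; split=> //.
  - by move=> i; rewrite ffunE rpred0.
  - by rewrite big1 // => i _; rewrite ffunE.
  - by apply/ffunP=> i; rewrite !ffunE add0r.
have := bS; rewrite -uS => /(calSP _ capPP)[a' [b' [a'P b'Q a'0 /ffunP eq]]].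
have ub i : u i b = a' i + b'.
  have -> : u i b = coordwise u ([ffun=> b] : Rk) i by rewrite coordwiseE;
    congr (u i _); rewrite ffunE.
  by rewrite eq ffunE.
(* Modulo Phi, u fixes b, while its image is b' modulo Phi; so b + b' lies in both Phi and Psi. *)
have bb' : b = b'.
  apply/eqP; rewrite -addv_eq0; apply/eqP/capPhiPsi; last by rewrite rpredD.
  have : b + u i0 b \in Phi by apply: fixPhi_move.
  by rewrite ub addrCA rpredDl.
rewrite -[RHS]a'0; apply: eq_bigr => i _.
have [uO uP] := fixPhiP _ (uU i).
rewrite (isometryD uO) uP // addrACA addvv add0r ub -bb'.
by rewrite addrCA addvv addr0.
Qed.

(** If s moved i, coordinate i of the right side would not depend on coordinate i of the argument;
    comparing [at_coord i a] with 0, for a nonzero, refutes this. *)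
Lemma coordwise_permcoord_inj h h' s :
  coordwise h = (coordwise h' * permcoord R s)%g -> s = 1%g /\ h = h'.
Proof.
move=> hh'; pose a : R := e (Ordinal m_gt0).
have a0 : a != 0.
  apply: contraNneq (oner_neq0 'F_2) => a0;
    have := ef_dual (Ordinal m_gt0) (Ordinal m_gt0).
  by rewrite -/a a0 polar0l // eqxx => <-.
have s1 : s = 1%g.
  apply/permP=> i; rewrite perm1; apply/eqP; apply: contraTT isT => si.
  have hE (v : Rk) : h i ((v : {ffun 'I_k -> R}) i) =
      h' ((s^-1)%g i) ((v : {ffun 'I_k -> R}) ((s^-1)%g i)).
    by rewrite -coordwiseE hh' permM permcoordE coordwiseE.
  have := hE (at_coord i a); rewrite at_coordE at_coordN.
    have := hE 0; rewrite !ffunE => <- /perm_inj/eqP.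
    by rewrite (negbTE a0).
  by apply: contra si => /eqP {1}<-; rewrite permKV.
split=> //; apply/ffunP=> i; apply/permP=> b.
have := congr1
  (fun g : {perm Rk} => (g (at_coord i b) : {ffun 'I_k -> R}) i) hh'.
by rewrite s1 permM permcoordE !coordwiseE invg1 perm1 at_coordE.
Qed.

Lemma permcoord1 : permcoord R (1 : 'S_k)%g = 1%g.
Proof. by apply/permP=> v; apply/ffunP=> i;
  rewrite permcoordE invg1 !perm1. Qed.

Lemma coordwise_inj : injective (@coordwise R k).
Proof.
move=> h h' hh'; have [] // := @coordwise_permcoord_inj h h' 1%g.
by rewrite permcoord1 mulg1.
Qed.

Lemma balanced_abelem : (2.-abelem N)%g.
Proof.
apply/abelemP=> //; have [_ U2] := abelemP (isT : prime 2) fixPhi_abelem.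
have cU := abelem_abelian fixPhi_abelem.
split=> [|_ /imsetP[u uB ->]].
  apply/centsP=> _ /imsetP[u uB ->] _ /imsetP[v vB ->].
  have [uU _] := balancedP _ uB; have [vU _] := balancedP _ vB.
  rewrite /commute -!coordwiseM; congr coordwise; apply/ffunP=> i;
    rewrite !ffunE.
  exact: (centsP cU).
have [uU _] := balancedP _ uB.
rewrite expgS expg1 -coordwiseM -(coordwise1 R k); congr coordwise.
by apply/ffunP=> i; rewrite !ffunE -(U2 _ (uU i)) expgS expg1.
Qed.

(** * Order and generators of the group of balanced tuples *)

Section Generators.
Variable i1 : 'I_k.

(** When the other entries lie in U, entry [i1] is forced to be their product, since U has exponent
    two; balanced tuples therefore correspond to k - 1 free elements of U. *)
Definition complete (u : {ffun 'I_k -> {perm fR}}) : {ffun 'I_k -> {perm fR}} :=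
  [ffun i => if i == i1 then (\prod_(j | j != i1) u j)%g else u i].

Lemma complete_balanced (u : {ffun 'I_k -> {perm fR}}) :
  (forall i, i != i1 -> u i \in U) -> complete u \in balanced.
Proof.
move=> uU; apply/balancedP; split=> [i | r].
  by rewrite ffunE; case: ifP => [_|/negbT/uU//]; apply: group_prod.
rewrite (bigD1 i1) //= ffunE eqxx fixPhi_prod //.
rewrite [X in _ + X](eq_bigr (fun j => r + u j r)) ?addvv // => i ii1.
by rewrite ffunE (negbTE ii1).
Qed.

Lemma balanced_complete h : h \in balanced ->
  h i1 = (\prod_(j | j != i1) h j)%g.
Proof.
case/balancedP=> hU h0; apply: fixPhi_eq => r; rewrite fixPhi_prod //.
by have := h0 r; rewrite (bigD1 i1) //= => /eqP; rewrite addv_eq0 => /eqP.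
Qed.

Lemma card_balanced_sub : #|N| = (2 ^ ((k - 1) * 'C(m, 2)))%N.
Proof.
rewrite (card_imset _ coordwise_inj).
rewrite mulnC expnM -card_fixPhi.
have <- : #|predC1 i1| = (k - 1)%N by rewrite cardC1 card_ord subn1.
(* [F] holds the families with values in U and the default 1 at [i1], an entry that [complete]
   overwrites. *)
rewrite -(card_pffun_on 1%g); set F := pffun_on _ _ _.
have Fon h : h \in F -> h i1 = 1%g /\ forall i, i != i1 -> h i \in U.
  case/pffun_onP=> /subsetP supp im; split=> [|i ii1].
    by apply/eqP; apply: contraT => u1; have := supp i1 u1; rewrite inE eqxx.
  by apply: im; apply: image_f; rewrite inE.
rewrite -[RHS](@card_in_imset _ _ complete) => [|u v uF vF /ffunP uv];
  last first.
  have [u1 _] := Fon u uF; have [v1 _] := Fon v vF; apply/ffunP=> i.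
  have [->|ii1] := eqVneq i i1; first by rewrite u1 v1.
  by have := uv i; rewrite !ffunE (negbTE ii1).
apply: eq_card => h; apply/idP/imsetP => [hB | [u /Fon[_ uU] ->]]; last first.
  exact: complete_balanced.
have [hU h0] := balancedP _ hB.
exists [ffun i => if i == i1 then 1%g else h i].
  apply/pffun_onP; split.
    by apply/subsetP=> i; rewrite !inE ffunE; case: ifP; rewrite ?eqxx.
  by move=> _ /imageP[i ii1 ->]; rewrite ffunE; case: ifP; rewrite ?group1 ?hU.
apply/ffunP=> i; rewrite !ffunE; have [->|ii1] := eqVneq i i1; last by [].
rewrite balanced_complete //; apply: eq_bigr => j ji1.
by rewrite ffunE (negbTE ji1).
Qed.

Definition pair_ffun (i : 'I_k) (g : {perm fR}) : {ffun 'I_k -> {perm fR}} :=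
  [ffun l => if (l == i1) || (l == i) then g else 1%g].

Lemma pair_subE i (A : {set {perm fR}}) : i != i1 ->
  pair_sub i1 i A = [set coordwise (pair_ffun i g) | g in A].
Proof.
move=> ii1; apply/setP=> x; apply/imsetP/imsetP => [[h] | [g gA ->]].
  rewrite inE => /and3P[/eqP h1i hA /forallP h1] ->; exists (h i1) => //.
  congr coordwise; apply/ffunP=> l; rewrite ffunE.
  have := h1 l; case: eqVneq => [->//|li1]; case: eqVneq => [->//|li] /=.
  by move/eqP.
exists (pair_ffun i g) => //; rewrite inE !ffunE !eqxx orbT gA eqxx /=.
apply/forallP=> l; apply/implyP=> /andP[li1 li].
by rewrite ffunE (negbTE li1) (negbTE li).
Qed.

Lemma pair_balanced i g : i != i1 -> g \in U -> pair_ffun i g \in balanced.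
Proof.
move=> ii1 gU; apply/balancedP; split=> [l | r].
  by rewrite ffunE; case: ifP.
rewrite (bigD1 i1) //= (bigD1 i) //= !ffunE !eqxx orbT big1 ?addr0 ?addvv //.
by move=> l /andP[li1 li]; rewrite ffunE (negbTE li1) (negbTE li) perm1 addvv.
Qed.

Lemma pair_sub_elementary i : i != i1 -> elementary2 (pair_sub i1 i U) 'C(m, 2).
Proof.
move=> ii1; split; last first.
  rewrite -card_fixPhi pair_subE // card_imset // => g g'
    /coordwise_inj/ffunP/(_ i1).
  by rewrite !ffunE eqxx.
apply: (abelemS _ balanced_abelem); rewrite /= pair_subE //.
by apply/subsetP=> _ /imsetP[g gU ->]; apply: imset_f; apply: pair_balanced.
Qed.

(** Away from [i1] only one factor acts on a given coordinate; at [i1] all of them do, and balance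
    says that their product is h i1. *)
Lemma balanced_pairs h : h \in balanced ->
  coordwise h = (\prod_(i | i != i1) coordwise (pair_ffun i (h i)))%g.
Proof.
move=> hB; have [hU _] := balancedP _ hB.
have prodE (I : Type) (r : seq I) (P : pred I)
    (F : I -> {ffun 'I_k -> {perm fR}}) :
    (\prod_(i <- r | P i) coordwise (F i))%g =
    coordwise [ffun l => (\prod_(i <- r | P i) F i l)%g].
  elim: r => [|x r IH].
    by rewrite big_nil -coordwise1; congr coordwise; apply/ffunP=> l;
      rewrite !ffunE big_nil.
  rewrite big_cons; case Px: (P x).
    rewrite IH -coordwiseM; congr coordwise; apply/ffunP=> l.
    by rewrite !ffunE big_cons Px.
  by rewrite IH; congr coordwise; apply/ffunP=> l; rewrite !ffunE big_cons Px.
rewrite prodE; congr coordwise; apply/ffunP=> l; rewrite ffunE.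
have [->|li1] := eqVneq l i1.
  rewrite balanced_complete //; apply: eq_bigr => i _.
  by rewrite ffunE eqxx.
apply: fixPhi_eq => r; rewrite fixPhi_prod => [|i _]; last first.
  by rewrite ffunE; case: ifP.
rewrite (bigD1 l) //= ffunE eqxx orbT big1 ?addr0 // => i /andP[ii1 il].
by rewrite ffunE (negbTE li1) eq_sym (negbTE il) perm1 addvv.
Qed.

End Generators.

(** * The complement K x Sym_k *)

Local Notation C := (diag_sub k K <*> Sym_sub R k)%g.

Lemma complement_dprod : (diag_sub k K \x Sym_sub R k = C)%g.
Proof.
apply: dprodEY.
  apply/centsP=> _ /imsetP[s _ ->] _ /imsetP[g _ ->].
  apply/permP=> v; rewrite !permM; apply/ffunP=> i.
  by rewrite coordwiseE !permcoordE coordwiseE !ffunE.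
apply/trivgP/subsetP=> x /setIP[/imsetP[g gK ->] /imsetP[s _ gs]].
have := @coordwise_permcoord_inj [ffun=> g] [ffun=> 1%g] s.
rewrite coordwise1 mul1g => /(_ gs)[_ ->].
by rewrite inE coordwise1.
Qed.

Lemma complementP (x : {perm Rk}) : x \in C ->
  exists (g : {perm fR}) s,
    g \in K /\ x = (coordwise [ffun=> g] * permcoord R s)%g.
Proof.
have [_ <- _ _] := dprodP complement_dprod.
case/imset2P=> _ _ /imsetP[g gK ->] /imsetP[s _ ->] ->.
by exists g, s.
Qed.

Lemma diag_normal_balanced g : g \in K -> coordwise [ffun=> g] \in 'N(N)%g.
Proof.
move=> gK; rewrite inE; apply/subsetP=> _ /imsetP[_ /imsetP[u uB ->] ->].
have [uU u0] := balancedP _ uB; have [gO _ _] := stabPhiPsiP _ gK.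
have gH : g \in H by case/setIP: gK.
apply/imsetP; exists [ffun i => (u i ^ g)%g].
  apply/balancedP; split=> [i | r].
    by rewrite ffunE memJ_norm // (subsetP (normal_norm fixPhi_normal)).
  rewrite -[RHS](isometry0 gO) -[X in _ = g X](u0 (g^-1 r)%g) (isometry_sum gO).
  apply: eq_bigr => i _.
  by rewrite ffunE conjgE !permM (isometryD gO) permKV.
rewrite conjgE (_ : (coordwise [ffun=> g])^-1 = coordwise [ffun=> g^-1])%g.
  rewrite -!coordwiseM; congr coordwise; apply/ffunP=> i.
  by rewrite !ffunE conjgE.
apply/eqP; rewrite eq_invg_mul -coordwiseM -coordwise1; apply/eqP;
  congr coordwise.
by apply/ffunP=> i; rewrite !ffunE mulgV.
Qed.

Lemma permcoord_normal_balanced s : permcoord R s \in 'N(N)%g.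
Proof.
rewrite inE; apply/subsetP=> _ /imsetP[_ /imsetP[u uB ->] ->].
have [uU u0] := balancedP _ uB.
apply/imsetP; exists [ffun i => u ((s^-1)%g i)].
  apply/balancedP; split=> [i | r]; first by rewrite ffunE.
  rewrite -[RHS](u0 r) (reindex_inj (@perm_inj _ s)).
  by apply: eq_bigr => i _; rewrite ffunE permK.
apply/permP=> v; rewrite conjgE !permM; apply/ffunP=> i.
rewrite permcoordE !coordwiseE ffunE; congr (u _ _).
have {2}-> : v = permcoord R s ((permcoord R s)^-1%g v) by rewrite permKV.
by rewrite permcoordE.
Qed.

Lemma complement_norm : (C \subset 'N(N))%g.
Proof.
rewrite join_subG; apply/andP; split.
  by apply/subsetP=> _ /imsetP[g gK ->]; apply: diag_normal_balanced.
by apply/subsetP=> _ /imsetP[s _ ->]; apply: permcoord_normal_balanced.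
Qed.

(** By uniqueness of the monomial form every entry of such a tuple equals one element g, which lies
    in both U and K. *)
Lemma complement_trivial : (N :&: C)%g = 1%g.
Proof.
apply/trivgP/subsetP=> x /setIP[/imsetP[u uB ->] /complementP[g [s [gK ug]]]].
have [_ ugE] := coordwise_permcoord_inj ug.
have [uU _] := balancedP _ uB.
pose i0 := Ordinal (leq_trans (isT : (0 < 3)%N) k_ge3).
have g1 : g = 1%g.
  by apply: stab_trivIset => //; have := uU i0; rewrite ugE ffunE.
by rewrite ugE g1 coordwise1 inE.
Qed.

(** * G as a split extension, once its elements are known to be monomial *)

Hypothesis G_monomial : forall g : {perm Rk}, g \in G ->
  exists h : {ffun 'I_k -> {perm fR}}, exists s : 'S_k,
    (forall i, h i \in preservers q) /\ g = (coordwise h * permcoord R s)%g.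

Lemma stabS_decompose (x : {perm Rk}) : x \in G ->
  exists (u : {ffun 'I_k -> {perm fR}}) (g : {perm fR}) s,
    [/\ u \in balanced, g \in K
    & x = (coordwise u * coordwise [ffun=> g] * permcoord R s)%g].
Proof.
move=> xG; have [h [s [hO xE]]] := G_monomial xG.
have hG : coordwise h \in G.
  by rewrite -(mulgK (permcoord R s) (coordwise h)) -xE groupM ?groupV
    ?permcoord_stabS.
have [u [g [uB gK hE]]] := coordwise_stabS hO hG.
by exists u, g, s; rewrite -hE.
Qed.

Lemma stabS_sdprod : (N ><| C = G)%g.
Proof.
rewrite sdprodE ?complement_norm ?complement_trivial //.
apply/eqP; rewrite eqEsubset mul_subG /=; last 2 first.
- by apply/subsetP=> _ /imsetP[u uB ->]; apply: balanced_stabS.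
- rewrite join_subG; apply/andP; split.
    by apply/subsetP=> _ /imsetP[g gK ->]; apply: diag_stabS.
  by apply/subsetP=> _ /imsetP[s _ ->]; apply: permcoord_stabS.
apply/subsetP=> x /stabS_decompose[u [g [s [uB gK ->]]]].
rewrite -mulgA; apply: mem_mulg; first exact: imset_f.
apply: groupM; first by apply: (subsetP (joing_subl _ _)); apply: imset_f.
by apply: (subsetP (joing_subr _ _)); apply: imset_f.
Qed.

Lemma stabS_gen (i1 : 'I_k) :
  G = << (\bigcup_(i | i != i1) pair_sub i1 i U)
           :|: diag_sub k K :|: Sym_sub R k >>%g.
Proof.
apply/eqP; rewrite eqEsubset; apply/andP; split; last first.
  rewrite gen_subG !subUset -andbA; apply/and3P; split.
  - apply/bigcupsP=> i ii1; rewrite pair_subE //.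
    apply/subsetP=> _ /imsetP[g gU ->]; apply: balanced_stabS.
    exact: pair_balanced.
  - by apply/subsetP=> _ /imsetP[g gK ->]; apply: diag_stabS.
  - by apply/subsetP=> _ /imsetP[s _ ->]; apply: permcoord_stabS.
apply/subsetP=> x /stabS_decompose[u [g [s [uB gK ->]]]].
apply: groupM; last first.
  by apply/mem_gen/setUP; right; apply: imset_f.
apply: groupM; last first.
  by apply/mem_gen/setUP; left; apply/setUP; right; apply: imset_f.
rewrite (balanced_pairs i1 uB) group_prod // => i ii1.
apply/mem_gen/setUP; left; apply/setUP; left; apply/bigcupP; exists i => //.
have [uU _] := balancedP _ uB.
by rewrite pair_subE //; apply: imset_f; apply: uU.
Qed.

Lemma diag_isog : (diag_sub k K \isog K)%g.
Proof.
pose i0 := Ordinal (leq_trans (isT : (0 < 3)%N) k_ge3).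
pose d (g : {perm fR}) := coordwise ([ffun=> g] : {ffun 'I_k -> _}).
have dM : {in K &, {morph d : x y / (x * y)%g}}.
  move=> x y _ _; rewrite /d -coordwiseM; congr coordwise.
  by apply/ffunP=> i; rewrite !ffunE.
have -> : diag_sub k K = (Morphism dM @* K)%g by rewrite morphimEdom.
rewrite isog_sym sub_isog //; apply/injmP=> g g' gK g'K.
by move/coordwise_inj/ffunP/(_ i0); rewrite !ffunE.
Qed.

Lemma Sym_isog : (Sym_sub R k \isog [set: 'S_k])%g.
Proof.
have sM : {in [set: 'S_k] &, {morph (@permcoord R k) : x y / (x * y)%g}}.
  by move=> s t _ _; apply: permcoordM.
have -> : Sym_sub R k = (Morphism sM @* [set: 'S_k])%g.
  by rewrite morphimEdom; apply/setP=> x; apply/imsetP/imsetP => [] [s _ ->];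
    exists s; rewrite ?inE.
rewrite isog_sym sub_isog //; apply/injmP=> s t _ _ /= st.
have := @coordwise_permcoord_inj [ffun=> 1%g] [ffun=> 1%g] (t * s^-1)%g.
rewrite coordwise1 mul1g permcoordM -st -permcoordM mulgV permcoord1.
case=> // ts _; by apply/eqP; rewrite eq_mulgV1 -eq_invg1 invMg invgK ts.
Qed.

End HyperbolicCoordinates.

(** * K as a special linear group, and the conclusion *)

Lemma stabPhiPsi_isog_SL (n : nat) (R : vectType 'F_2) (q : R -> 'F_2)
    (Phi Psi : {vspace R}) (e f : 'I_n.+1 -> R) :
  quadratic_form q -> \dim {:R} = (2 * n.+1)%N ->
  totally_singular q Phi -> totally_singular q Psi ->
  (forall i, e i \in Phi) -> (forall i, f i \in Psi) ->
  (forall i j, polar q (e i) (f j) = (i == j)%:R) ->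
  ('N_('N_(preservers q)(vset Phi | 'P))(vset Psi | 'P) \isog SL n.+1 'F_2)%g.
Proof.
move=> qq dimR tsPhi tsPsi eP fP ef; set K := ('N__(vset Psi | 'P))%g.
have uL (x : {'GL_n.+1['F_2]}) : (GLval x : 'M_n.+1) \in unitmx := GL_unitmx x.
pose L (x : {'GL_n.+1['F_2]}) : {perm finvect_type R} :=
  lift_perm qq dimR tsPhi tsPsi eP fP ef (uL x).
have LE x r : L x r = lift_mx q e f (GLval x) r by rewrite permE.
have LM : {in [set: {'GL_n.+1['F_2]}] &, {morph L : x y / (x * y)%g}}.
  move=> x y _ _; apply/permP=> r; rewrite permM !LE.
  by rewrite (lift_mxM qq tsPhi tsPsi eP fP ef _ (uL x) (uL y)).
(* The only nonzero determinant over F_2 is 1. *)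
have SLT : SL n.+1 'F_2 = [set: {'GL_n.+1['F_2]}].
  apply/setP=> x; rewrite !inE; apply/eqP/F2_neq0.
  by have := uL x; rewrite unitmxE unitfE.
have -> : K = (Morphism LM @* [set: {'GL_n.+1['F_2]}])%g.
  rewrite morphimEdom; apply/setP=> g; apply/idP/imsetP => [gK | [x _ ->]].
    have [A [uA ->]] := stabPhiPsi_lift qq dimR tsPhi tsPsi eP fP ef gK.
    exists (FinRing.Unit (uA : (A : 'M_n.+1) \is a GRing.unit) :
      {'GL_n.+1['F_2]}).
      by rewrite inE.
    by apply/permP=> r; rewrite [RHS]LE permE.
  exact: lift_perm_stab.
rewrite SLT isog_sym sub_isog //; apply/injmP=> x y _ _ /= /permP xy.
apply: val_inj; apply/row_matrixP=> i; rewrite !rowE.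
have := xy (comb e f (delta_mx 0 i) 0); rewrite !LE /lift_mx.
by move/(congr1 (xcoord q f)); rewrite !(xcoordK qq tsPhi tsPsi eP fP ef).
Qed.

Theorem proposition2p5 (m k : nat) (R : vectType 'F_2) (q : R -> 'F_2)
    (Phi Psi : {vspace R}) (i1 : 'I_k) :
  (0 < m)%N ->
  quadratic_form q ->
  nonsingular q ->
  plus_type q m ->
  max_totally_singular q Phi ->
  max_totally_singular q Psi ->
  i1 = 0%N :> nat ->
  (3 <= k)%N ->
  (m = 2 -> 5 <= k)%N ->
  (Phi :&: Psi = 0)%VS ->
  let G := ('N_(preservers (@weight_pow R q k))(calS k Phi Psi | 'P))%G in
  let H := ('N_(preservers q)(vset Phi | 'P))%G in
  let K := ('N_H(vset Psi | 'P))%G in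
  [/\ G :=: << (\bigcup_(i | i != i1) pair_sub i1 i 'O_2(H)%g)
               :|: diag_sub k K :|: Sym_sub R k >>%g,
      forall i, i != i1 -> elementary2 (pair_sub i1 i 'O_2(H)%g) 'C(m, 2),
      diag_sub k K \isog SL m 'F_2
    & exists N C : {group {perm finvect_type {ffun 'I_k -> R}}},
        [/\ (N ><| C)%g = G,
            elementary2 N ((k - 1) * 'C(m, 2))
          & C \isog setX (SL m 'F_2) [set: 'S_k]]].
Proof.
move=> m_gt0 qq ns [dimR dimts] maxPhi maxPsi _ k3 k5 cap0 G H K.
have [tsPhi tsPsi] := (proj1 maxPhi, proj1 maxPsi).
have dimPhi := dimts _ maxPhi.
have [e [f [eP fP ef]]] :=
  dual_bases qq ns tsPhi tsPsi dimR dimPhi (dimts _ maxPsi) cap0.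
have pcoreE : 'O_2(H)%g = ('C_(preservers q)(vset Phi | 'P))%g.
  exact: pcore_stabPhi qq dimR tsPhi tsPsi eP fP ef m_gt0.
have Phi0 : Phi != 0%VS by rewrite -dimv_eq0 dimPhi -lt0n.
have R_unit : exists z, q z = 1.
  pose i0 := Ordinal m_gt0; exists (e i0 + f i0).
  by rewrite quadD (tsPhi _ (eP i0)) (tsPsi _ (fP i0)) ef eqxx !add0r.
have G_iso : G \subset preservers (@weight_pow R q k) by apply: subsetIl.
have G_block g i z z' : g \in G -> q z = 1 -> q z' = 1 ->
    same_block (g (at_coord i z)) (g (at_coord i z')).
  move=> gG qz qz'; have gw := subsetP G_iso g gG.
  (* For m = 2 the nonorthogonality graph on the vectors with q = 1 is disconnected, so the blocks
     are recognised through [calS] instead. *)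
  have [m2|m2] := eqVneq m 2%N;
    last exact: (same_block_dim qq ns i dimR m2 gw qz qz').
  exact: (same_block_calS qq cap0 tsPhi (k5 m2) i Phi0 gG qz qz').
have G_mono := monomial qq ns R_unit G_iso G_block.
have diagK := diag_isog Phi Psi qq ef m_gt0 k3.
have isoK : K \isog SL m 'F_2.
  (* Exposes m as a successor, the form in which matrices of ['GL_m] have size m. *)
  case: (m) dimR e f eP fP ef m_gt0 => // n dimR' e f eP fP ef _.
  exact: stabPhiPsi_isog_SL qq dimR' tsPhi tsPsi eP fP ef.
have isoD := isog_trans diagK isoK.
split=> //.
- rewrite pcoreE; exact (stabS_gen qq dimR tsPhi tsPsi eP fP ef k3 G_mono i1).
- rewrite pcoreE => i; exact:
    (pair_sub_elementary qq dimR tsPhi tsPsi eP fP ef m_gt0).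
exists (balanced_group qq dimR tsPhi tsPsi eP fP ef k), (diag_sub k K <*>
  Sym_sub R k)%G; split.
- exact (stabS_sdprod qq dimR tsPhi tsPsi eP fP ef m_gt0 k3 G_mono).
- split; first exact: balanced_abelem qq dimR tsPhi tsPsi eP fP ef k.
  exact: (card_balanced_sub qq dimR tsPhi tsPsi eP fP ef m_gt0 i1).
have dp := complement_dprod Phi Psi qq ef k m_gt0.
apply: (isog_dprod dp (setX_dprod _ _)).
  apply: isog_trans isoD _; rewrite /= -morphim_pairg1 sub_isog ?subsetT //.
  exact: injm_pairg1.
apply: isog_trans (Sym_isog qq ef k m_gt0) _;
  rewrite /= -morphim_pair1g sub_isog ?subsetT //.
exact: injm_pair1g.
Qed.
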